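(* Let $m\ge 2$, $n=m(m-1)/2$, let $\mathbb{G}$ be the free step-two homogeneous Carnot group of $m$ generators (of dimension $N=m+n$), endowed with the Riemannian metric $g$ for which the Jacobian basis $(X_i)_{1\le i\le m}$, $(\Gamma_{h,k})_{1\le k<h\le m}$ is orthonormal, and let $\nabla^g$ be the Levi-Civita connection of $g$. Then $(\mathbb{G},\nabla^g)$ has full holonomy group $H^{\nabla^g}=\mathrm{SO}(m+n)$.
   Context: Let $\mathcal{I}=\{(h,k):1\le k<h\le m\}$, of cardinality $n$. $\mathbb{G}=(\mathbb{R}^{m+n},\star)$, with points $(v,\gamma)$, $v\in\mathbb{R}^m$, $\gamma=(\gamma_{h,k})_{(h,k)\in\mathcal{I}}\in\mathbb{R}^n$, and group law $(v,\gamma)\star(v',\gamma')=\big((v_i+v_i')_{1\le i\le m},\ (\gamma_{h,k}+\gamma'_{h,k}+\frac12(v_hv'_k-v_kv'_h))_{(h,k)\in\mathcal{I}}\big)$. The Jacobian basis of its Lie algebra consists of the left-invariant vector fields $X_h=\frac{\partial}{\partial v_h}+\frac12\sum_{h<i\le m}v_i\frac{\partial}{\partial\gamma_{i,h}}-\frac12\sum_{1\le j<h}v_j\frac{\partial}{\partial\gamma_{h,j}}$ ($1\le h\le m$) and $\Gamma_{h,k}=\frac{\partial}{\partial\gamma_{h,k}}$ ($(h,k)\in\mathcal{I}$); one has $[X_h,X_k]=\Gamma_{h,k}$ for $h>k$, and the $\Gamma_{h,k}$ are central. The holonomy group at $x$ is $H^{\nabla^g}|_x=\{(P^{\nabla^g})_0^1(\gamma):\gamma:[0,1]\to\mathbb{G}\text{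 absolutely continuous loop based at }x\}$, where $(P^{\nabla^g})_0^1(\gamma)$ is parallel transport along $\gamma$; $H^{\nabla^g}\subset\mathrm{SO}(m+n)$ is the corresponding group, defined up to conjugation by identifying $T_x\mathbb{G}$ with Euclidean $\mathbb{R}^{m+n}$ through an (oriented) orthonormal basis. *)

(* Defs.v *)
From HB Require Import structures.
From mathcomp Require Import all_boot all_order all_algebra.
From mathcomp Require Import all_classical all_reals all_analysis.
From mathcomp Require Import ring.

Set Implicit Arguments.
Unset Strict Implicit.
Unset Printing Implicit Defensive.

Import Order.TTheory GRing.Theory Num.Theory.
Import numFieldNormedType.Exports.

Local Open Scope classical_set_scope.
Local Open Scope ring_scope.

(** Points of R^N and tangent vectors are row vectors in the global chart; an
    endomorphism of a tangent space is a matrix acting by [u |-> u *m P]. *)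

Section Riemannian.
Variables (R : realType) (N : nat).

Definition vfield := 'rV[R]_N -> 'rV[R]_N.

Fixpoint Ck (k : nat) (X : vfield) : Prop :=
  if k is k'.+1
  then (forall p, differentiable X p) /\ (forall v, Ck k' ('D_v X))
  else continuous X.

Definition smooth (X : vfield) := forall k, Ck k X.

(** A field of bilinear forms on the tangent spaces: [g p u w = g_p(u, w)]. *)
Definition tensor2 := 'rV[R]_N -> 'rV[R]_N -> 'rV[R]_N -> R.

(** An affine connection on R^N, given by its Christoffel symbols in the global
    chart: [D k i j p] is the coefficient of d_k in nabla_{d_i} d_j at [p].
    No regularity is imposed, as [levi_civita] below determines [D]. *)
Definition connection := 'I_N -> 'I_N -> 'I_N -> 'rV[R]_N -> R.

Definition christoffel (D : connection) (p u w : 'rV[R]_N) : 'rV[R]_N :=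
  \row_k \sum_i \sum_j D k i j p * u 0 i * w 0 j.

Definition nabla (D : connection) (X Y : vfield) : vfield :=
  fun p => 'D_(X p) Y p + christoffel D p (X p) (Y p).

Definition lie_bracket (X Y : vfield) : vfield :=
  fun p => 'D_(X p) Y p - 'D_(Y p) X p.

Definition torsion_free (D : connection) :=
  forall X Y, smooth X -> smooth Y ->
  forall p, nabla D X Y p - nabla D Y X p = lie_bracket X Y p.

Definition metric_compatible (g : tensor2) (D : connection) :=
  forall X Y Z, smooth X -> smooth Y -> smooth Z ->
  forall p, 'D_(X p) (fun q => g q (Y q) (Z q)) p
            = g p (nabla D X Y p) (Z p) + g p (Y p) (nabla D X Z p).

Definition levi_civita (g : tensor2) (D : connection) :=
  torsion_free D /\ metric_compatible g D.

Definition abs_continuous01 (c : R -> 'rV[R]_N) :=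
  forall e : R, 0 < e -> exists2 d : R, 0 < d &
    forall (k : nat) (a b : 'I_k -> R),
      (forall i, 0 <= a i /\ a i <= b i /\ b i <= 1) ->
      trivIset [set: 'I_k] (fun i => `]a i, b i[%classic) ->
      \sum_i (b i - a i) < d -> \sum_i `|c (b i) - c (a i)| < e.

(** Curves are functions on R of which only the restriction to [0, 1] matters:
    the null set of exceptional times absorbs the two end points. *)
Definition parallel_along (D : connection) (c V : R -> 'rV[R]_N) :=
  abs_continuous01 V /\
  {ae (@lebesgue_measure R), forall t : R, 0 <= t <= 1 ->
     [/\ derivable c t 1, derivable V t 1
       & 'D_1 V t + christoffel D (c t) ('D_1 c t) (V t) = 0]}.

(** [P] is the parallel transport from time 0 to time 1 along [c]. *)
Definition parallel_transport (D : connection) (c : R -> 'rV[R]_N)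
    (P : 'M[R]_N) :=
  forall u w, u *m P = w <->
    exists V, [/\ parallel_along D c V, V 0 = u & V 1 = w].

Definition holonomy (D : connection) (x : 'rV[R]_N) : set 'M[R]_N :=
  [set P | exists c : R -> 'rV[R]_N,
     [/\ abs_continuous01 c, c 0 = x, c 1 = x & parallel_transport D c P]].

(** The rows of [B] are the vectors of the basis. *)
Definition oriented_orthonormal_basis (g : tensor2) (x : 'rV[R]_N)
    (B : 'M[R]_N) :=
  (forall a b, g x (row a B) (row b B) = (a == b)%:R) /\ 0 < \det B.

(** Matrices, in the basis [B] of the tangent space, of the elements of the
    holonomy group at [x]. *)
Definition holonomy_in_basis (D : connection) (x : 'rV[R]_N) (B : 'M[R]_N) :
    set 'M[R]_N :=
  [set B *m P *m invmx B | P in holonomy D x].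

Definition SO : set 'M[R]_N := [set A | A *m A^T = 1%:M /\ \det A = 1].

End Riemannian.

Arguments SO : clear implicits.

Section KoszulFormula.
Variables (R : realType) (N : nat) (G : 'rV[R]_N -> 'M[R]_N).
Hypothesis Gsym : forall p, (G p)^T = G p.
Hypothesis Gunit : forall p, G p \in unitmx.
Hypothesis Gdiff : forall p i j, differentiable (fun q => G q i j : R) p.

Let g : tensor2 R N := fun p u w => \sum_i \sum_j G p i j * u 0 i * w 0 j.
Let dG (i j l : 'I_N) (p : 'rV[R]_N) : R :=
  'D_(delta_mx 0 i) (fun q => G q j l : R) p.
Let Koszul i j l p := 2^-1 * (dG i j l p + dG j i l p - dG l i j p).
Let D : connection R N := fun k i j p =>
  (invmx (G p) *m \col_l Koszul i j l p) k 0.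

Let GsymE p i j : G p i j = G p j i.
Proof. by rewrite -[in RHS]Gsym mxE. Qed.

Let dGsym i j l p : dG i j l p = dG i l j p.
Proof.
rewrite /dG; suff -> : (fun q => G q j l) = (fun q => G q l j) by [].
by apply/funext => q; exact: GsymE.
Qed.

Let GD i j l p : \sum_k G p l k * D k i j p = Koszul i j l p.
Proof.
have := congr1 (fun M : 'cV_N => M l 0)
  (mulKVmx (Gunit p) (\col_a Koszul i j a p)).
by rewrite [in X in _ = X]mxE => <-; rewrite mxE.
Qed.

Let g_christoffel p u w z : g p z (christoffel D p u w) =
  \sum_i \sum_j \sum_l Koszul i j l p * u 0 i * w 0 j * z 0 l.
Proof.
rewrite /g.
transitivity (\sum_l \sum_i \sum_j \sum_k
    G p l k * D k i j p * u 0 i * w 0 j * z 0 l).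
  apply: eq_bigr => l _; under eq_bigr => k _.
    rewrite mxE mulr_sumr; under eq_bigr do rewrite mulr_sumr.
    over.
  rewrite exchange_big; apply: eq_bigr => i _.
  rewrite exchange_big; apply: eq_bigr => j _.
  by apply: eq_bigr => k _; ring.
rewrite exchange_big; apply: eq_bigr => i _.
rewrite exchange_big; apply: eq_bigr => j _.
apply: eq_bigr => l _.
by rewrite -GD !mulr_suml.
Qed.

Let gsym p u w : g p u w = g p w u.
Proof.
rewrite /g exchange_big; apply: eq_bigr => i _; apply: eq_bigr => j _.
by rewrite GsymE mulrAC.
Qed.

Let gDr p u w z : g p u (w + z) = g p u w + g p u z.
Proof.
rewrite /g -big_split; apply: eq_bigr => i _; rewrite -big_split.
by apply: eq_bigr => j _; rewrite mxE mulrDr.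
Qed.

Lemma derive_coord (X : vfield R N) p v i : differentiable X p ->
  is_derive p v (fun q => X q 0 i : R) (('D_v X p) 0 i).
Proof.
move=> dX.
have dv : derivable X p v by exact: diff_derivable.
have /derivable_mxP dc := dv.
apply: DeriveDef; first exact: dc.
by rewrite derive_mx // mxE.
Qed.

Lemma koszul_levi_civita : levi_civita g D.
Proof.
split=> [X Y _ _ p|X Y Z _ sY sZ p].
  rewrite /nabla /lie_bracket opprD addrACA.
  suff -> : christoffel D p (X p) (Y p) = christoffel D p (Y p) (X p).
    by rewrite subrr addr0.
  apply/rowP => k; rewrite !mxE exchange_big.
  apply: eq_bigr => i _; apply: eq_bigr => j _.
  suff -> : D k j i p = D k i j p by ring.
  congr ((_ *m _) _ _); apply/matrixP => l o; rewrite !mxE.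
  by rewrite /Koszul [dG l j i p]dGsym [_ + dG i _ _ _]addrC.
rewrite /nabla gDr [g p (_ + _) _]gsym gDr !g_christoffel [g p (Z p) _]gsym.
have dY i := derive_coord (X p) i (proj1 (sY 1%N) p).
have dZ i := derive_coord (X p) i (proj1 (sZ 1%N) p).
have dGG i j : is_derive p (X p) (fun q => G q i j : R)
    (\sum_k X p 0 k * dG k i j p).
  apply: DeriveDef; first exact: diff_derivable.
  rewrite deriveE // [X in 'd _ _ X]row_sum_delta linear_sum.
  by apply: eq_bigr => k _; rewrite linearZ /= /dG deriveE.
have gE : (fun q => g q (Y q) (Z q)) = \sum_i \sum_j
    ((fun q => G q i j : R) * (fun q => Y q 0 i : R) * (fun q => Z q 0 j : R)).
  apply/funext => q; rewrite fct_sumE; apply: eq_bigr => i _.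
  by rewrite fct_sumE.
rewrite gE derive_val.
transitivity (g p ('D_(X p) Y p) (Z p) + g p (Y p) ('D_(X p) Z p) +
    \sum_i \sum_j \sum_k dG k i j p * X p 0 k * Y p 0 i * Z p 0 j).
  rewrite /g -!big_split; apply: eq_bigr => i _.
  rewrite -!big_split; apply: eq_bigr => j _ /=.
  rewrite /GRing.scale /=.
  transitivity (G p i j * 'D_(X p) Y p 0 i * Z p 0 j
    + G p i j * Y p 0 i * 'D_(X p) Z p 0 j +
    (\sum_k X p 0 k * dG k i j p) * Y p 0 i * Z p 0 j).
    by rewrite ?fctE; ring.
  congr (_ + _); rewrite !mulr_suml; apply: eq_bigr => k _.
  by rewrite [X p 0 k * _]mulrC.
rewrite [RHS]addrACA; congr (_ + _).
have sw (F : 'I_N -> 'I_N -> 'I_N -> R) : \sum_i \sum_j \sum_k F i j k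
    = \sum_k \sum_i \sum_j F i j k.
  by under eq_bigr do rewrite exchange_big; rewrite exchange_big.
rewrite sw -big_split; apply: eq_bigr => k _.
rewrite [X in _ = _ + X]exchange_big -big_split; apply: eq_bigr => i _ /=.
rewrite -big_split; apply: eq_bigr => j _ /=.
by rewrite /Koszul (dGsym k j i); field.
Qed.
End KoszulFormula.

(** The index set {(h, k) : k < h}, with 0-based indices. *)
Definition pairs (m : nat) := {p : 'I_m * 'I_m | (p.2 < p.1)%N}.
Notation npairs m := #|{: pairs m}|.

Lemma card_pairs m : npairs m = (m * m.-1)./2.
Proof.
rewrite card_sig -bin2 -bin2_sum big_mkord -sum1_card.
rewrite -(pair_big_dep xpredT (fun i j : 'I_m => (j < i)%N) (fun _ _ => 1%N)) /=.
apply: eq_bigr => i _.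
rewrite -(big_ord_widen _ (fun=> 1%N) (ltnW (ltn_ord i))).
by rewrite sum1_card card_ord.
Qed.

Section Carnot.
Variables (R : realType) (m : nat).
Local Notation n := (npairs m).
Local Notation G := 'rV[R]_(m + n).
Implicit Types (x y : G) (p : pairs m) (h : 'I_m).

Definition hidx p : 'I_m := (val p).1.
Definition kidx p : 'I_m := (val p).2.

Definition vcoord x h : R := x 0 (lshift n h).
Definition gcoord x p : R := x 0 (rshift m (enum_rank p)).

Definition mkpoint (v : 'I_m -> R) (ga : pairs m -> R) : G :=
  row_mx (\row_i v i) (\row_a ga (enum_val a)).

Definition star x y : G :=
  mkpoint (fun i => vcoord x i + vcoord y i)
          (fun p => gcoord x p + gcoord y p
             + 2^-1 * (vcoord x (hidx p) * vcoord y (kidx p)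
                       - vcoord x (kidx p) * vcoord y (hidx p))).

(** The rows are the values at [x] of the Jacobian basis, i.e. of the
    left-invariant fields which agree with the coordinate fields at 0: first
    the [X_h], then the [Gamma_{h,k}]. *)
Definition jacobian_basis x : 'M[R]_(m + n) := jacobian (star x) 0.

(** The metric for which the Jacobian basis is orthonormal: [u *m invmx _] is
    the row of the coordinates of [u] in that basis. *)
Definition carnot_metric : tensor2 R (m + n) := fun x u w =>
  let F := invmx (jacobian_basis x) in
  \sum_a (u *m F) 0 a * (w *m F) 0 a.

(** The explicit matrix of the Jacobian basis: the row of index [i] is
    X_i = d/dv_i + 1/2 sum_(h > i) v_h d/dgamma_{h,i}
          - 1/2 sum_(k < i) v_k d/dgamma_{i,k}. *)
Definition frame x : 'M[R]_(m + n) := block_mx 1%:M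
  (\matrix_(i, a) (let p := enum_val a in
     2^-1 * ((i == kidx p)%:R * vcoord x (hidx p)
             - (i == hidx p)%:R * vcoord x (kidx p)))) 0 1%:M.

Lemma starE x y : star x y = x + y *m frame x.
Proof.
rewrite -[y in y *m _]hsubmxK /frame mul_row_block.
rewrite -[X in _ = X + _]hsubmxK.
rewrite !mulmx1 mulmx0 addr0 add_row_mx; congr row_mx.
  by apply/rowP => i; rewrite !mxE.
apply/rowP => a; rewrite !mxE /gcoord !enum_valK.
set p := enum_val a.
rewrite -addrA; congr (_ + _); rewrite addrC; congr (_ + _).
have sel (c : R) k : \sum_j lsubmx y 0 j * (2^-1 * ((j == k)%:R * c)) =
    2^-1 * (vcoord y k * c).
  rewrite (bigD1 k) //= eqxx big1 ?addr0 => [|j /negbTE ->].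
    by rewrite mxE mul1r mulrCA.
  by rewrite mul0r !mulr0.
under eq_bigr do rewrite !mxE -/p mulrBr mulrBr.
rewrite sumrB.
rewrite [LHS]mulrBr ![vcoord x _ * vcoord y _]mulrC -!sel.
by congr (_ - _); apply: eq_bigr => j _; rewrite mxE.
Qed.

Lemma jacobian_basisE x : jacobian_basis x = frame x.
Proof.
have cM : continuous (mulmxr (frame x) : G -> G).
  move=> y; apply: differentiable_continuous.
  rewrite (_ : mulmxr _ = \sum_i (fun z : G => z 0 i *: row i (frame x) : G)).
    apply: differentiable_sum => i; apply: differentiableZl.
    exact: differentiable_coord.
  by apply/funext => z; rewrite fct_sumE /= mulmx_sum_row.
have E : star x = cst x + mulmxr (frame x).
  by apply/funext => y; rewrite starE.
have dM : differentiable (mulmxr (frame x) : G -> G) 0.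
  exact: linear_differentiable.
have dS : differentiable (star x) 0.
  by rewrite E; apply: differentiableD => //; exact: differentiable_cst.
have dL : 'd (mulmxr (frame x) : G -> G) 0 = mulmxr (frame x) :> (G -> G).
  exact: diff_lin.
have dD (v : G) : is_derive 0 v (star x) (0 + v *m frame x).
  rewrite E; apply: is_deriveD.
  by apply: DeriveDef; [exact: diff_derivable | rewrite deriveE // dL].
apply/row_matrixP => i; rewrite !rowE -(deriveEjacobian _ dS).
by rewrite (@derive_val _ _ _ _ _ _ _ (dD _)) add0r.
Qed.

Lemma jacobian_basis_unit x : jacobian_basis x \in unitmx.
Proof. by rewrite jacobian_basisE unitmxE det_ublock !det1 mulr1 unitr1. Qed.

Lemma jacobian_basis_orthonormal x a b :
  carnot_metric x (row a (jacobian_basis x)) (row b (jacobian_basis x))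
  = (a == b)%:R.
Proof.
rewrite /carnot_metric -!row_mul mulmxV ?jacobian_basis_unit //.
rewrite (bigD1 a) //= big1 ?addr0 => [|c ca]; rewrite !mxE.
  by rewrite eqxx mul1r eq_sym.
by rewrite eq_sym (negbTE ca) mul0r.
Qed.

Lemma jacobian_basis_inv x : invmx (jacobian_basis x) = 2%:M - jacobian_basis x.
Proof.
apply: (can_inj (mulKmx (jacobian_basis_unit x))).
rewrite mulmxV ?jacobian_basis_unit // jacobian_basisE mulmxBr mul_mx_scalar.
rewrite /frame mulmx_block scale_block_mx opp_block_mx add_block_mx.
rewrite !(mul1mx, mulmx1, mul0mx, mulmx0, addr0, add0r, scaler0, subr0).
rewrite !scaler_nat !mulr2n !addrK subrr.
by rewrite oppr0 -scalar_mx_block.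
Qed.

Lemma jacobian_basis_differentiable a b x :
  differentiable (fun y => jacobian_basis y a b : R) x.
Proof.
have -> : (fun y => jacobian_basis y a b) = (fun y => frame y a b : R).
  by apply/funext => y; rewrite jacobian_basisE.
have cst_diff (c : R) (f : G -> R) : (forall y, f y = c) -> differentiable f x.
  by move=> fc; rewrite (_ : f = cst c); [exact: differentiable_cst | apply/funext].
case: (split_ordP a) => i ->; case: (split_ordP b) => j ->.
- by apply: cst_diff => y; rewrite /frame block_mxEul.
- pose k := kidx (enum_val j : pairs m); pose h := hidx (enum_val j : pairs m).
  rewrite (_ : (fun _ => _) = cst (2^-1 * (i == k)%:R) * (fun y : G => vcoord y h)
      - cst (2^-1 * (i == h)%:R) * (fun y : G => vcoord y k)); last first.
    by apply/funext => y; rewrite /frame block_mxEur mxE mulrBr !mulrA.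
  by apply: differentiableB; apply: differentiableM;
    solve [exact: differentiable_cst | exact: differentiable_coord].
- by apply: cst_diff => y; rewrite /frame block_mxEdl.
- by apply: cst_diff => y; rewrite /frame block_mxEdr.
Qed.

(** The hypothesis [levi_civita carnot_metric D] is satisfiable. *)
Lemma carnot_levi_civita_exists : exists D, levi_civita carnot_metric D.
Proof.
pose Fi (x : G) := invmx (jacobian_basis x).
have -> : carnot_metric = fun q u w : G => \sum_i \sum_j
    (Fi q *m (Fi q)^T) i j * u 0 i * w 0 j.
  apply/funext => q; apply/funext => u; apply/funext => w.
  rewrite /carnot_metric /= -/(Fi q).
  under eq_bigr => a _.
    rewrite !mxE mulr_suml; under eq_bigr do rewrite mulr_sumr.
    over.
  rewrite exchange_big; apply: eq_bigr => i _.
  rewrite exchange_big; apply: eq_bigr => j _.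
  rewrite mxE !mulr_suml; apply: eq_bigr => a _.
  by rewrite mxE; ring.
eexists; apply: koszul_levi_civita => [p|p|p i j].
- by rewrite trmx_mul trmxK.
- by rewrite unitmx_mul unitmx_tr unitmx_inv jacobian_basis_unit.
have -> : (fun q => (Fi q *m (Fi q)^T) i j) =
    \sum_k ((fun q => Fi q i k) * (fun q => Fi q j k)).
  apply/funext => q; rewrite mxE fct_sumE.
  by apply: eq_bigr => k _; rewrite mxE.
have dF a b : differentiable (fun q => Fi q a b : R) p.
  rewrite (_ : (fun _ => _) = cst ((2%:M : 'M[R]_(m + n)) a b)
      - (fun q => jacobian_basis q a b : R)); last first.
    apply/funext => q; rewrite /Fi jacobian_basis_inv mxE; congr (_ + _).
    by rewrite [LHS]mxE.
  apply: differentiableB; first exact: differentiable_cst.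
  exact: jacobian_basis_differentiable.
by apply: differentiable_sum => k; exact: differentiableM.
Qed.

End Carnot.

Arguments carnot_metric : clear implicits.

(* Main.v *)
Require Import Defs.
From HB Require Import structures.
From mathcomp Require Import all_boot all_order all_algebra.
From mathcomp Require Import all_classical all_reals all_analysis.
From mathcomp Require Import perm ring lra.
Import Order.TTheory GRing.Theory Num.Theory.
Import numFieldNormedType.Exports.
Local Open Scope classical_set_scope.
Local Open Scope ring_scope.

Set Implicit Arguments.
Unset Strict Implicit.
Unset Printing Implicit Defensive.

(** In the left-invariant frame the Levi-Civita connection has constant
    coefficients: along a curve of velocity b (in frame coordinates), the frame
    coordinates a of a parallel field solve a' = - a * spin(b), where spin(b)
    is a fixed skew matrix depending linearly on b ([christoffel_frame],
    [coords_derive]).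

    Skewness gives the inclusion in SO.  Inner products of parallel fields are
    absolutely continuous with zero derivative almost everywhere, hence constant
    ([ac01_derive0], [parallel_isometry]); the transports of the frame up to time
    t form a continuous path of orthogonal matrices from the identity, so their
    determinant stays 1 ([transport_SO]).  The same conservation law shows that
    parallel fields are determined by their initial value.

    For the other inclusion, moving along a basis field e_a transports by the
    one-parameter group of spin(e_a).  As 2 spin(e_a) satisfies J^3 = - J, this
    group is given by Rodrigues' formula and is periodic.  Let h > k, and follow
    a rectangle whose sides in direction X_h have exactly one period as length.
    These two sides transport trivially and the sides in direction X_k
    cancel, so the rectangle has no rotation at all; but it is not closed, its
    end points differing by a multiple of Gamma_{h,k}.  Closing it along
    Gamma_{h,k} contributes a rotation of the plane (X_k, X_h), by an arbitrary
    angle since the other side of the rectangle is free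
    ([horizontal_rotation]).

    By left invariance the matrices obtained from loops are the same at every
    base point, so they are stable under conjugation by transports along open
    paths.  A quarter turn along X_h sends X_k to Gamma_{h,k} and fixes X_h,
    which yields all rotations of the plane (Gamma_{h,k}, X_h)
    ([vertical_rotation]).  These planes connect all basis vectors, so every
    rotation of a coordinate plane comes from a loop, and such rotations
    generate SO by Givens elimination ([rotations_generate]). *)

(** * Absolutely continuous functions on the unit interval *)

Section AbsoluteContinuity.
Variable R : realType.
Implicit Types f : R -> R.

(** The condition of [abs_continuous01] for an arbitrary normed target, so that
    it also applies to coordinates and matrix entries. *)
Definition ac01 (V : normedModType R) (f : R -> V) :=
  forall e : R, 0 < e -> exists2 d : R, 0 < d &
    forall (k : nat) (a b : 'I_k -> R),
      (forall i, 0 <= a i /\ a i <= b i /\ b i <= 1) ->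
      trivIset [set: 'I_k] (fun i => `]a i, b i[%classic) ->
      \sum_i (b i - a i) < d -> \sum_i `|f (b i) - f (a i)| < e.

(** Cousin's lemma.  Let z be the supremum of the t in [0, b] with P 0 t: the
    local hypothesis at z joins some such t near z to a point beyond z, unless
    z = b. *)
Lemma segment_induction (b : R) (P : R -> R -> Prop) : 0 <= b ->
  (forall s t u : R, 0 <= s -> s <= t -> t <= u -> u <= b ->
     P s t -> P t u -> P s u) ->
  (forall x : R, 0 <= x <= b -> exists2 d : R, 0 < d &
     forall s t : R, 0 <= s -> s <= x -> x <= t -> t <= b -> t - s < d -> P s t) ->
  P 0 b.
Proof.
move=> b0 Padd Ploc.
pose S := [set t : R | 0 <= t <= b /\ P 0 t].
have S0 : S 0.
  split; first lra.
  have [|d d0 H] := Ploc 0; first lra.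
  by apply: H; lra.
have Sub : has_sup S.
  split; first by exists 0.
  by exists b => t [/andP[]].
have [_ ubS] := Sub.
have [z zE] : exists z, z = sup S by exists (sup S).
have z0 : 0 <= z by rewrite zE; exact: (ub_le_sup ubS).
have z1 : z <= b by rewrite zE; apply: ge_sup; [exists 0 | move=> t [/andP[]]].
have [|d d0 H] := Ploc z; first lra.
have [|t [/andP[t0 t1] P0t] tz] := @sup_adherent _ S (d / 2) _ Sub.
  lra.
have tle : t <= z by rewrite zE; apply: (ub_le_sup ubS); split => //; lra.
rewrite -zE in tz.
pose u := Num.min b (z + d / 4).
have [u1 uz zu] : [/\ u <= b, u <= z + d / 4 & z <= u].
  by rewrite /u; case: (leP b (z + d / 4)) => h; split; lra.
have Su : S u.
  split; first lra.
  apply: (Padd 0 t u) => //; try lra.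
  by apply: H => //; lra.
have ule : u <= z by rewrite zE; exact: (ub_le_sup ubS).
have <- : u = b.
  by move: ule; rewrite /u; case: (leP b (z + d / 4)) => h ?; lra.
by case: Su.
Qed.

Lemma ac01_lipschitz (V : normedModType R) (f : R -> V) K :
  (forall s t : R, 0 <= s -> s <= t -> t <= 1 -> `|f t - f s| <= K * (t - s)) ->
  ac01 f.
Proof.
move=> fK e e0; pose M := `|K| + 1.
have M0 : 0 < M by rewrite /M ltr_wpDl.
exists (e / M); first by rewrite divr_gt0.
move=> k a b ab _ sd.
apply: (@le_lt_trans _ _ (\sum_i M * (b i - a i))).
  apply: ler_sum => i _; have [a0 [aib b1]] := ab i.
  apply: le_trans (fK _ _ a0 aib b1) _; apply: ler_wpM2r; first lra.
  by rewrite /M; have := ler_norm K; lra.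
by rewrite -mulr_sumr mulrC -ltr_pdivlMr.
Qed.

Lemma ac01_cst (V : normedModType R) (v : V) : ac01 (fun=> v).
Proof. by apply: (@ac01_lipschitz _ _ 0) => *; rewrite subrr normr0 mul0r. Qed.

Lemma ac01D (V : normedModType R) (f g : R -> V) :
  ac01 f -> ac01 g -> ac01 (fun t => f t + g t).
Proof.
move=> acf acg e e0; have e2 : 0 < e / 2 by rewrite divr_gt0.
have [d1 d10 H1] := acf _ e2; have [d2 d20 H2] := acg _ e2.
exists (Num.min d1 d2); first by rewrite lt_min d10.
move=> k a b ab tr; rewrite lt_min => /andP[s1 s2].
have h1 := H1 _ _ _ ab tr s1; have h2 := H2 _ _ _ ab tr s2.
suff : \sum_i `|f (b i) + g (b i) - (f (a i) + g (a i))| <=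
  \sum_i `|f (b i) - f (a i)| + \sum_i `|g (b i) - g (a i)| by lra.
rewrite -big_split; apply: ler_sum => i _ /=.
by rewrite opprD addrACA ler_normD.
Qed.

Lemma ac01_sum (V : normedModType R) I (r : seq I) (F : I -> R -> V) :
  (forall i, ac01 (F i)) -> ac01 (fun t => \sum_(i <- r) F i t).
Proof.
move=> acF; elim: r => [|i r IH].
  by under eq_fun do rewrite big_nil; exact: ac01_cst.
under eq_fun do rewrite big_cons.
exact: ac01D (acF i) IH.
Qed.

Lemma ler_coord_norm N (u : 'rV[R]_N) i : `|u 0 i| <= `|u|.
Proof.
rewrite [X in _ <= X]mx_normrE.
exact: (le_bigmax _ (fun i => `|u i.1 i.2|) (0, i)).
Qed.

Lemma ac01_coord N (c : R -> 'rV[R]_N) i :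
  abs_continuous01 c -> ac01 (fun t => c t 0 i : R).
Proof.
move=> acc e e0; have [d d0 H] := acc e e0; exists d => // k a b ab tr sd.
apply: le_lt_trans (H _ _ _ ab tr sd); apply: ler_sum => j _.
rewrite (_ : _ - _ = (c (b j) - c (a j)) 0 i); last by rewrite !mxE.
exact: ler_coord_norm.
Qed.

Lemma ac01_modulus (V : normedModType R) (f : R -> V) : ac01 f ->
  forall e : R, 0 < e -> exists2 d : R, 0 < d &
    forall s t : R, 0 <= s <= 1 -> 0 <= t <= 1 -> `|t - s| < d -> `|f t - f s| < e.
Proof.
move=> acf e e0; have [d d0 H] := acf e e0; exists d => // s t.
wlog st : s t / s <= t.
  move=> W s01 t01; case: (leP s t) => [|/ltW] st; first exact: W.
  by rewrite distrC [`|f _ - _|]distrC; exact: W.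
move=> s01 t01; rewrite ger0_norm ?subr_ge0 // => std.
have := H 1%N (fun=> s) (fun=> t); rewrite !big_ord1; apply=> //.
- by move=> _; lra.
- by move=> i j _ _ _; rewrite !ord1.
Qed.

Lemma ac01_continuous f : ac01 f -> {within `[0, 1], continuous f}.
Proof.
move=> acf; apply/subspace_continuousP => s /=.
rewrite in_itv /= => s01; apply/cvgrPdist_lt => e e0.
have [d d0 H] := ac01_modulus acf e0.
rewrite near_withinE; near=> t => /=; rewrite in_itv /= => t01.
apply: H => //; near: t; exact: nbhsx_ballx.
Unshelve. all: by end_near. Qed.

Lemma ac01_bounded f : ac01 f ->
  exists2 M, 0 < M & forall t, 0 <= t <= 1 -> `|f t| <= M.
Proof.
move=> acf.
have cf : {within `[0, 1], continuous (fun t => `|f t|)}.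
  by move=> t; apply: cvg_norm; exact: ac01_continuous.
have [z _ zM] := EVT_max ler01 cf.
exists (`|f z| + 1); first by rewrite ltr_wpDl.
by move=> t t01; have := zM t; rewrite in_itv /= => /(_ t01); lra.
Qed.

Lemma ac01M f g : ac01 f -> ac01 g -> ac01 (fun t => f t * g t).
Proof.
move=> acf acg e e0.
have [M M0 fM] := ac01_bounded acf; have [L L0 gL] := ac01_bounded acg.
have eL : 0 < e / 2 / L by rewrite !divr_gt0.
have eM : 0 < e / 2 / M by rewrite !divr_gt0.
have [d1 d10 H1] := acf _ eL; have [d2 d20 H2] := acg _ eM.
exists (Num.min d1 d2); first by rewrite lt_min d10.
move=> k a b ab tr; rewrite lt_min => /andP[s1 s2].
have := H1 _ _ _ ab tr s1; have := H2 _ _ _ ab tr s2.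
rewrite !ltr_pdivlMr // => h2 h1.
suff : \sum_i `|f (b i) * g (b i) - f (a i) * g (a i)| <=
  (\sum_i `|f (b i) - f (a i)|) * L + (\sum_i `|g (b i) - g (a i)|) * M by lra.
rewrite !mulr_suml -big_split; apply: ler_sum => i _ /=.
have [a0 [aib b1]] := ab i.
rewrite (_ : _ - _ = (f (b i) - f (a i)) * g (b i) +
                     (g (b i) - g (a i)) * f (a i)); last by ring.
apply: le_trans (ler_normD _ _) _; rewrite !normrM.
by apply: lerD; apply: ler_wpM2l => //; [apply: gL | apply: fM]; lra.
Qed.

Lemma is_derive0_locally f (x : R) : is_derive x 1 f 0 ->
  forall e : R, 0 < e -> exists2 d : R, 0 < d &
    forall y, `|y - x| < d -> `|f y - f x| <= e * `|y - x|.
Proof.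
move=> [df f'0] e e0.
have : h^-1 *: (f (h *: (1 : R) + x) - f x) @[h --> 0^'] --> (0 : R).
  by rewrite -[X in _ --> X]f'0; exact: df.
move=> /cvgrPdist_lt /(_ e e0); rewrite near_withinE => /nbhs_ballP[d /= d0 H].
exists d => // y yx; have [->|yNx] := eqVneq y x.
  by rewrite !subrr normr0 mulr0.
have yx0 : y - x != 0 by rewrite subr_eq0.
have := H (y - x); rewrite /ball /= sub0r normrN => /(_ yx yx0).
rewrite sub0r normrN /GRing.scale /= mulr1 subrK normrM normfV.
by rewrite mulrC ltr_pdivrMr ?normr_gt0 // => /ltW.
Qed.

Lemma sum_itv_le_open k (a b : 'I_k -> R) (U : set R) (d : R) :
  measurable U -> (@lebesgue_measure R U < d%:E)%E ->
  (forall i, a i <= b i) ->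
  trivIset [set: 'I_k] (fun i => `]a i, b i[%classic) ->
  (forall i, `]a i, b i[%classic `<=` U) ->
  \sum_i (b i - a i) < d.
Proof.
move=> mU Ud ab tr sU.
have E : (@lebesgue_measure R (\big[setU/set0]_(i < k) `]a i, b i[%classic)
    = (\sum_i (b i - a i))%:E)%E.
  rewrite measure_bigsetU_ord //.
  rewrite -sumEFin; apply: eq_bigr => i _.
  apply: etrans (lebesgue_measure_itv `]a i, b i[%R) _.
  rewrite /= lte_fin; case: ltP => // h.
  by rewrite (_ : b i = a i) ?subrr //; apply/eqP; rewrite eq_le h ab.
rewrite -lte_fin -E; apply: le_lt_trans Ud.
apply: le_measure; rewrite ?inE //.
  by apply: bigsetU_measurable => i _.
by apply: (big_ind (fun A => A `<=` U)) => // A B AU BU z [/AU|/BU].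
Qed.

(** Absolute continuity is what excludes Cantor functions.  Enclose the
    exceptional null set in an open set U whose measure is below the modulus of
    absolute continuity for e / 2, and cut the segment ([segment_induction])
    into pieces that are contained in U or on which the increment of f is at
    most e / 2 times the length.  The former contribute less than e / 2 in all,
    by absolute continuity, and the latter at most e / 2. *)
Lemma ac01_derive0 f : ac01 f ->
  {ae (@lebesgue_measure R), forall t : R, 0 <= t <= 1 -> is_derive t 1 f 0} ->
  forall b, 0 <= b <= 1 -> f b = f 0.
Proof.
move=> acf [E [mE E0 sE]] r r01.
apply/eqP; rewrite -subr_eq0 -normr_le0; apply/ler_addgt0Pr => e e0.
have e2 : 0 < e / 2 by rewrite divr_gt0.
have [d d0 Hd] := acf _ e2.
have [|U [oU EU Ud]] := lebesgue_regularity_outer mE _ d0; first by apply: (@eq_ind_r _ _ (fun r => (r < +oo)%E) _ _ E0).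
have mU : measurable U by exact: measurable_realfun.open_measurable.
have {}Ud : (@lebesgue_measure R U < d%:E)%E.
  apply: le_lt_trans Ud.
  rewrite -{1}(setDUK EU) measureU //=; last 2 first.
  - exact: measurableD.
  - by rewrite setDE setICA setICr setI0.
  by rewrite [X in (X + _)%E](_ : _ = 0%E) ?add0e //; exact: E0.
pose P s t := exists k (a b : 'I_k -> R),
  [/\ forall i, s <= a i /\ a i <= b i /\ b i <= t,
      trivIset [set: 'I_k] (fun i => `]a i, b i[%classic),
      forall i, `]a i, b i[%classic `<=` U &
      `|f t - f s| <= e / 2 * (t - s) + \sum_i `|f (b i) - f (a i)|].
have : P 0 r.
  apply: segment_induction => [|s t u s0 st tu u1|x x0r]; first lra.
    move=> [k1 [a1 [b1 [ab1 tr1 U1 H1]]]] [k2 [a2 [b2 [ab2 tr2 U2 H2]]]].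
    pose glue (c1 : 'I_k1 -> R) (c2 : 'I_k2 -> R) (i : 'I_(k1 + k2)) :=
      match fintype.split i with inl j => c1 j | inr j => c2 j end.
    have gl c1 c2 (i : 'I_k1) : glue c1 c2 (lshift k2 i) = c1 i.
      by rewrite /glue (unsplitK (inl i)).
    have gr c1 c2 (i : 'I_k2) : glue c1 c2 (rshift k1 i) = c2 i.
      by rewrite /glue (unsplitK (inr i)).
    exists (k1 + k2)%N, (glue a1 a2), (glue b1 b2); split.
    - move=> i; case: (split_ordP i) => j ->; rewrite ?gl ?gr.
        by have := ab1 j; lra.
      by have := ab2 j; lra.
    - move=> i j _ _; case: (split_ordP i) => i' ->; case: (split_ordP j) => j' ->.
      + by rewrite !gl => h; congr lshift; exact: tr1.
      + rewrite !gl !gr => -[z [/=]]; rewrite !in_itv /= => /andP[_ zb] /andP[az _].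
        have := lt_trans az zb; rewrite ltNge => /negP[].
        by have := ab1 i'; have := ab2 j'; lra.
      + rewrite !gl !gr => -[z [/=]]; rewrite !in_itv /= => /andP[az _] /andP[_ zb].
        have := lt_trans az zb; rewrite ltNge => /negP[].
        by have := ab1 j'; have := ab2 i'; lra.
      + by rewrite !gr => h; congr rshift; exact: tr2.
    - by move=> i; case: (split_ordP i) => j ->; rewrite ?gl ?gr; [exact: U1 | exact: U2].
    - rewrite big_split_ord /=.
      under eq_bigr do rewrite !gl; under [X in _ + (_ + X)]eq_bigr do rewrite !gr.
      have := ler_normD (f u - f t) (f t - f s); rewrite addrA subrK.
      lra.
  have [Ux|nUx] := pselect (U x).
    have /nbhs_ballP[rho /= r0 rU] : nbhs x U by exact: open_nbhs_nbhs.
    exists rho => // s t s0 sx xt t1 str.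
    (* Near a point of U, the whole piece [s, t] is listed. *)
    exists 1%N, (fun=> s), (fun=> t); split.
    - by move=> _; lra.
    - by move=> i j _ _ _; rewrite !ord1.
    - move=> _ z /=; rewrite in_itv /= => szt; apply: rU.
      by rewrite /ball /= ltr_norml; lra.
    - by rewrite big_ord1 lerDr mulr_ge0 //; lra.
  (* Elsewhere f is stationary to first order, and nothing is listed. *)
  have dx : is_derive x 1 f 0.
    by apply: contrapT => ndx; apply/nUx/EU/sE => /(_ ltac:(lra)).
  have [rho r0 rH] := is_derive0_locally dx e2.
  exists rho => // s t s0 sx xt t1 str.
  exists 0%N, (fun=> 0), (fun=> 0); split; try by case.
  rewrite big_ord0 addr0.
  have := rH t; have := rH s.
  rewrite (ger0_norm (_ : 0 <= t - x)) ?subr_ge0 //.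
  rewrite (ler0_norm (_ : s - x <= 0)) ?subr_le0 // => hs ht.
  have {hs} := hs; have {ht} := ht.
  move=> /(_ ltac:(lra)) ht /(_ ltac:(lra)) hs.
  have := ler_normB (f t - f x) (f s - f x).
  rewrite opprB addrA subrK.
  lra.
move=> [k [a [b [ab tr sU H]]]]; rewrite add0r.
have sd : \sum_i (b i - a i) < d.
  by apply: (sum_itv_le_open mU Ud) => // i; have [_ []] := ab i.
have ab1 i : 0 <= a i /\ a i <= b i /\ b i <= 1 by have := ab i; lra.
have er : e / 2 * (r - 0) <= e / 2 by rewrite subr0 ler_piMr ?(ltW e2) //; case/andP: r01.
have := Hd _ _ _ ab1 tr sd; lra.
Qed.
End AbsoluteContinuity.

(** * Curves of matrices *)

Section MatrixCurves.
Variable R : realType.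

(** Differentiability is taken entry by entry: the product rule for matrices of
    any size is then that of real functions.  On row vectors it is the derivative
    of vector-valued curves, see [mx_derive_rV]. *)
Definition mx_derive p q (A : R -> 'M[R]_(p, q)) (t : R) (A' : 'M[R]_(p, q)) :=
  forall i j, is_derive t 1 (fun s => A s i j : R) (A' i j).

Lemma mx_derive_rV N (V : R -> 'rV[R]_N) (t : R) V' :
  mx_derive V t V' <-> derivable V t 1 /\ 'D_1 V t = V'.
Proof.
split=> [dV|[dV <-] i j].
  have d : derivable V t 1 by apply/derivable_mxP => i j; case: (dV i j).
  split=> //; rewrite derive_mx //; apply/matrixP => i j; rewrite mxE.
  by case: (dV i j).
have /derivable_mxP dc := dV.
by apply: DeriveDef; [exact: dc | rewrite derive_mx // mxE].
Qed.

Lemma mx_derive_cst p q (A : 'M[R]_(p, q)) t : mx_derive (fun=> A) t 0.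
Proof. by move=> i j; rewrite mxE; exact: is_derive_cst. Qed.

Lemma mx_deriveD p q (A B : R -> 'M[R]_(p, q)) t A' B' :
  mx_derive A t A' -> mx_derive B t B' ->
  mx_derive (fun s => A s + B s) t (A' + B').
Proof.
move=> dA dB i j; rewrite mxE; under eq_fun do rewrite mxE.
exact: is_deriveD.
Qed.

Lemma mx_deriveB p q (A B : R -> 'M[R]_(p, q)) t A' B' :
  mx_derive A t A' -> mx_derive B t B' ->
  mx_derive (fun s => A s - B s) t (A' - B').
Proof.
move=> dA dB i j; rewrite !mxE; under eq_fun do rewrite !mxE.
exact: is_deriveB.
Qed.

Lemma mx_deriveM p q r (A : R -> 'M[R]_(p, q)) (B : R -> 'M[R]_(q, r)) t A' B' :
  mx_derive A t A' -> mx_derive B t B' ->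
  mx_derive (fun s => A s *m B s) t (A' *m B t + A t *m B').
Proof.
move=> dA dB i j.
have -> : (fun s => (A s *m B s) i j) =
    \sum_k ((fun s => A s i k : R) * (fun s => B s k j : R)).
  by apply/funext => s; rewrite mxE fct_sumE.
have dAk k := dA i k; have dBk k := dB k j.
rewrite !mxE -big_split /=; apply: is_derive_eq.
by apply: eq_bigr => k _; rewrite /GRing.scale /=; ring.
Qed.

Lemma mx_derive_trmx p q (A : R -> 'M[R]_(p, q)) t A' :
  mx_derive A t A' -> mx_derive (fun s => (A s)^T) t A'^T.
Proof. by move=> dA i j; rewrite mxE; under eq_fun do rewrite mxE. Qed.

Lemma mx_derive_linear N p q (f : {linear 'rV[R]_N -> 'M[R]_(p, q)}) c t c' :
  mx_derive c t c' -> mx_derive (fun s => f (c s)) t (f c').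
Proof.
move=> dc i j.
have fE u : f u i j = \sum_k u 0 k * f (delta_mx 0 k) i j.
  rewrite {1}(row_sum_delta u) linear_sum summxE.
  by apply: eq_bigr => k _; rewrite linearZ mxE.
have -> : (fun s => f (c s) i j) =
    \sum_k ((fun s => c s 0 k : R) * cst (f (delta_mx 0 k) i j)).
  by apply/funext => s; rewrite fE fct_sumE.
rewrite fE; have dk k := dc 0 k; apply: is_derive_eq.
by apply: eq_bigr => k _; rewrite /GRing.scale /= mulr0 add0r mulrC.
Qed.

End MatrixCurves.

(** * The left-invariant frame *)

Section Frame.
Variables (R : realType) (m : nat).
Local Notation n := (npairs m).
Local Notation N := (m + npairs m)%N.
Local Notation G := 'rV[R]_N.

(** The row vector w *m shear u is half the bracket of the left-invariant fields
    of coordinates u and w; the moving frame is a perturbation of the identity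
    by this nilpotent matrix. *)
Definition shear (u : G) : 'M[R]_N := block_mx 0
  (\matrix_(i, a) (let p := enum_val a in
     2^-1 * ((i == kidx p)%:R * vcoord u (hidx p)
             - (i == hidx p)%:R * vcoord u (kidx p)))) 0 0.

Lemma frameE u : frame u = 1%:M + shear u.
Proof.
by rewrite /shear scalar_mx_block add_block_mx !addr0 add0r.
Qed.

Lemma shear_linear : linear shear.
Proof.
move=> k u w; rewrite !/shear scale_block_mx add_block_mx !scaler0 !addr0.
congr block_mx; apply/matrixP => i a; rewrite !mxE /vcoord !mxE; ring.
Qed.
HB.instance Definition _ := GRing.isLinear.Build R G 'M[R]_N *:%R shear shear_linear.

Lemma shearD u w : shear (u + w) = shear u + shear w.
Proof. exact: (linearD shear). Qed.

Lemma shearZ k u : shear (k *: u) = k *: shear u.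
Proof. by rewrite linearZ. Qed.

Lemma vcoord_shear w u h : vcoord (w *m shear u) h = 0.
Proof.
rewrite /vcoord -[w]hsubmxK /shear mul_row_block !mulmx0 addr0.
by rewrite row_mxEl mxE.
Qed.

(** The group has step two: brackets are vertical, and vertical vectors are
    central. *)
Lemma shear_mul_shear w u : shear (w *m shear u) = 0.
Proof.
rewrite /shear -[RHS](block_mx0 R m n m n); congr block_mx.
apply/matrixP => i a; rewrite [LHS]mxE [RHS]mxE /=.
by rewrite !vcoord_shear !mulr0 subrr mulr0.
Qed.

Lemma mul_shear_shear u w : shear u *m shear w = 0.
Proof.
by rewrite !/shear mulmx_block !(mul0mx, mulmx0, addr0) block_mx0.
Qed.

Lemma shear_frame u w : shear (u *m frame w) = shear u.
Proof. by rewrite frameE mulmxDr mulmx1 linearD /= shear_mul_shear addr0. Qed.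

Lemma point_eq (u w : G) : (forall h, vcoord u h = vcoord w h) ->
  (forall p, gcoord u p = gcoord w p) -> u = w.
Proof.
move=> ev eg; apply/rowP => i; case: (split_ordP i) => j ->; first exact: ev.
by have := eg (enum_val j); rewrite /gcoord enum_valK.
Qed.

Lemma gcoord_shear w u p : gcoord (w *m shear u) p = 2^-1 *
  (vcoord u (hidx p) * vcoord w (kidx p) - vcoord u (kidx p) * vcoord w (hidx p)).
Proof.
have -> : w *m shear u = star u w - u - w.
  by rewrite starE frameE mulmxDr mulmx1 [u + _]addrC addrK [w + _]addrC addrK.
have -> : gcoord (star u w - u - w) p = gcoord (star u w) p - gcoord u p - gcoord w p.
  by rewrite /gcoord !mxE.
rewrite [gcoord (star u w) p]/gcoord /star /mkpoint row_mxEr mxE enum_rankK; ring.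
Qed.

Lemma mul_shear_anti u w : w *m shear u = - (u *m shear w).
Proof.
apply: point_eq => [h|p].
  by rewrite vcoord_shear /vcoord mxE -/(vcoord _ h) vcoord_shear oppr0.
rewrite gcoord_shear /gcoord [RHS]mxE -/(gcoord _ p) gcoord_shear; ring.
Qed.

Lemma mul_shear_self u : u *m shear u = 0.
Proof.
have := mul_shear_anti u u => /eqP; rewrite -addr_eq0 -mulr2n -scaler_nat.
by rewrite scaler_eq0 pnatr_eq0 => /eqP.
Qed.

(** The inverse of the frame, because [shear x] has square zero. *)
Definition coframe (u : G) : 'M[R]_N := 1%:M - shear u.

Lemma mul_frame_coframe u : frame u *m coframe u = 1%:M.
Proof.
rewrite frameE /coframe mulmxDl !mulmxBr !mulmx1 mul1mx mul_shear_shear subr0.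
by rewrite subrK.
Qed.

Lemma mul_coframe_frame u : coframe u *m frame u = 1%:M.
Proof. exact: mulmx1C (mul_frame_coframe u). Qed.

Lemma invmx_jacobian_basis u : invmx (jacobian_basis u) = coframe u.
Proof.
rewrite jacobian_basis_inv jacobian_basisE frameE /coframe opprD addrA.
by congr (_ - _); rewrite -[2]/(1 + 1) raddfD /= addrK.
Qed.

Lemma carnot_metricE x u w :
  carnot_metric R m x u w = \sum_a (u *m coframe x) 0 a * (w *m coframe x) 0 a.
Proof. by rewrite /carnot_metric invmx_jacobian_basis. Qed.

Definition basis_field (a : 'I_N) : vfield R N := fun p => row a (frame p).

Lemma basis_fieldE a p : basis_field a p = delta_mx 0 a + delta_mx 0 a *m shear p.
Proof. by rewrite /basis_field rowE frameE mulmxDr mulmx1. Qed.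

Lemma differentiable_basis_field a p : differentiable (basis_field a) p.
Proof.
have -> : basis_field a = cst (delta_mx 0 a) +
   \sum_i (fun z : G => z 0 i *: (delta_mx 0 a *m shear (delta_mx 0 i)) : G).
  apply/funext => z; rewrite basis_fieldE fctE; congr (_ + _).
  rewrite fct_sumE {1}(row_sum_delta z) linear_sum mulmx_sumr.
  by apply: eq_bigr => k _; rewrite linearZ /= -scalemxAr.
apply: differentiableD; first exact: differentiable_cst.
apply: differentiable_sum => i; apply: differentiableZl.
exact: differentiable_coord.
Qed.

Lemma derive_basis_field a v p :
  'D_v (basis_field a) p = delta_mx 0 a *m shear v.
Proof.
rewrite /derive; apply: cvg_lim => //.
have E : {near 0^', (fun=> delta_mx 0 a *m shear v : G) =1
    (fun h : R => h^-1 *: ((basis_field a \o shift p) (h *: v) - basis_field a p))}.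
  near=> h.
  have h0 : h != 0 by near: h; exact: nbhs_dnbhs_neq.
  rewrite /= !basis_fieldE shearD shearZ mulmxDr -scalemxAr.
  rewrite opprD addrACA subrr add0r -addrA subrr addr0.
  by rewrite scalerA mulVf // scale1r.
apply: cvg_trans (near_eq_cvg E) _.
exact: cvg_cst.
Unshelve. all: by end_near. Qed.

Lemma smooth_cst (w : G) : smooth (cst w : vfield R N).
Proof.
move=> k; elim: k w => [|k IH] w /=.
  by move=> p; exact: cst_continuous.
split=> [p|v]; first exact: differentiable_cst.
have -> : 'D_v (cst w : vfield R N) = cst 0 by apply/funext => p; rewrite derive_cst.
exact: IH.
Qed.

Lemma smooth_basis_field a : smooth (basis_field a).
Proof.
case=> [|k] /=.
  by move=> p; apply/differentiable_continuous/differentiable_basis_field.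
split=> [p|v]; first exact: differentiable_basis_field.
have -> : 'D_v (basis_field a) = cst (delta_mx 0 a *m shear v).
  by apply/funext => p; rewrite derive_basis_field.
exact: smooth_cst.
Qed.

End Frame.

(** * The Levi-Civita connection in the left-invariant frame *)

Section Connection.
Variables (R : realType) (m : nat).
Local Notation N := (m + npairs m)%N.
Local Notation G := 'rV[R]_N.
Local Notation e_ a := (delta_mx 0 a : 'rV[R]_N).

Lemma delta_rowE a i : e_ a 0 i = (i == a)%:R.
Proof. by rewrite mxE eqxx. Qed.

(** The connection matrix of the frame: [w *m spin u] is the covariant derivative
    in direction u of the left-invariant field w.  The three terms are those of
    Koszul's formula when the structure constants are twice the entries of
    [shear]. *)
Definition spin (u : G) : 'M[R]_N := \matrix_(b, c)
  (shear u b c - shear u c b - \sum_a u 0 a * shear (e_ b) c a).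

Lemma spinE u b c : spin u b c =
  shear u b c - shear u c b - \sum_a u 0 a * shear (e_ b) c a.
Proof. by rewrite mxE. Qed.

Lemma spin_linear : linear spin.
Proof.
move=> k u w; apply/matrixP => b c.
have addE (A B : 'M[R]_N) i j : (k *: A + B) i j = k * A i j + B i j.
  by rewrite !mxE.
rewrite addE !spinE shearD shearZ !addE.
have -> : \sum_a (k *: u + w) 0 a * shear (e_ b) c a =
  k * (\sum_a u 0 a * shear (e_ b) c a) + \sum_a w 0 a * shear (e_ b) c a.
  rewrite mulr_sumr -big_split; apply: eq_bigr => a _ /=.
  have -> : (k *: u + w) 0 a = k * u 0 a + w 0 a by rewrite !mxE.
  by ring.
by ring.
Qed.
HB.instance Definition _ := GRing.isLinear.Build R G 'M[R]_N *:%R spin spin_linear.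

Lemma shear_delta_anti a b c : shear (e_ a) b c = - shear (e_ b) a c.
Proof.
have := congr1 (fun w : G => w 0 c) (mul_shear_anti (e_ a) (e_ b)).
rewrite -!rowE [row b _ 0 c]mxE => ->.
have NE (w : G) : (- w) 0 c = - w 0 c by rewrite mxE.
by rewrite NE; congr (- _); rewrite mxE.
Qed.

Lemma spin_delta a b c : spin (e_ a) b c =
  shear (e_ a) b c - shear (e_ a) c b - shear (e_ b) c a.
Proof.
rewrite spinE (bigD1 a) //= delta_rowE eqxx mul1r big1 ?addr0 // => i ia.
by rewrite delta_rowE (negbTE ia) mul0r.
Qed.

Lemma spin_anti u : (spin u)^T = - spin u.
Proof.
rewrite (row_sum_delta u) !linear_sum /=; apply: eq_bigr => a _.
rewrite !linearZ /=; congr (_ *: _).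
apply/matrixP => b c.
have NE (A : 'M[R]_N) : (- A) b c = - A b c by rewrite mxE.
have TE (A : 'M[R]_N) : A^T b c = A c b by rewrite mxE.
rewrite NE TE !spin_delta.
rewrite (shear_delta_anti c b) ; ring.
Qed.

Lemma linear_fun_sum (f : G -> G) (lf : linear f) (u : G) (e : 'I_N -> G) :
  f (\sum_i u 0 i *: e i) = \sum_i u 0 i *: f (e i).
Proof.
have fD : {morph f : x y / x + y} by move=> x y; have := lf 1 x y; rewrite !scale1r.
have f0 : f 0 = 0 by apply: (addrI (f 0)); rewrite -fD !addr0.
rewrite (big_morph f fD f0); apply: eq_bigr => i _.
by have := lf (u 0 i) (e i) 0; rewrite f0 !addr0.
Qed.

Variable D : connection R N.

Lemma christoffel_linearl p w : linear (fun u => christoffel D p u w).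
Proof.
move=> k u u'; apply/rowP => c; rewrite !mxE mulr_sumr -big_split.
apply: eq_bigr => i _; rewrite mulr_sumr -big_split; apply: eq_bigr => j _ /=.
by rewrite !mxE; ring.
Qed.

Lemma christoffel_linearr p u : linear (christoffel D p u).
Proof.
move=> k w w'; apply/rowP => c; rewrite !mxE mulr_sumr -big_split.
apply: eq_bigr => i _; rewrite mulr_sumr -big_split; apply: eq_bigr => j _ /=.
by rewrite !mxE; ring.
Qed.

Hypothesis hD : levi_civita (carnot_metric R m) D.

(** Uniqueness in Koszul's theorem.  Let w a b c be the component along e_c of
    the derivative of e_b in direction e_a.  Metric compatibility, applied to
    inner products that are constant, makes w antisymmetric in b and c, and
    vanishing torsion gives its antisymmetric part in a and b; together these
    linear relations determine w. *)
Lemma nabla_basis_field a b p :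
  nabla D (basis_field a) (basis_field b) p = row b (spin (e_ a)) *m frame p.
Proof.
pose w a b c := (nabla D (basis_field a) (basis_field b) p *m coframe p) 0 c.
have coE (c : 'I_N) q : basis_field c q *m coframe q = e_ c.
  by rewrite /basis_field rowE -mulmxA mul_frame_coframe mulmx1.
have gE q u c : carnot_metric R m q u (basis_field c q) = (u *m coframe q) 0 c.
  rewrite carnot_metricE coE (bigD1 c) //= big1 => [|i ic].
      by rewrite delta_rowE eqxx mulr1 addr0.
  by rewrite delta_rowE (negbTE ic) mulr0.
have gC q u u' : carnot_metric R m q u u' = carnot_metric R m q u' u.
  by rewrite !carnot_metricE; apply: eq_bigr => i _; rewrite mulrC.
have anti a1 b1 c1 : w a1 b1 c1 = - w a1 c1 b1.
  have := hD.2 _ _ _ (@smooth_basis_field R m a1) (@smooth_basis_field R m b1)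
     (@smooth_basis_field R m c1) p.
  rewrite gE gC gE -/(w a1 b1 c1) -/(w a1 c1 b1).
  have -> : (fun q => carnot_metric R m q (basis_field b1 q) (basis_field c1 q))
      = cst (e_ b1 0 c1).
    by apply/funext => q; rewrite gE coE.
  rewrite derive_cst => /esym/eqP; rewrite addr_eq0 => /eqP; exact.
have tor a1 b1 c1 : w a1 b1 c1 - w b1 a1 c1 = shear (e_ a1) b1 c1 *+ 2.
  have := hD.1 _ _ (@smooth_basis_field R m a1) (@smooth_basis_field R m b1) p.
  rewrite /lie_bracket !derive_basis_field.
  move=> /(congr1 (fun u => (u *m coframe p) 0 c1)).
  have BE (u u' : G) : (u - u') 0 c1 = u 0 c1 - u' 0 c1 by rewrite !mxE.
  rewrite mulmxBl BE -/(w a1 b1 c1) -/(w b1 a1 c1) => ->.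
  rewrite /basis_field !rowE !shear_frame.
  rewrite mulmxBl /coframe !mulmxBr !mulmx1 -!mulmxA !mul_shear_shear !mulmx0 !subr0.
  have rE a2 b2 : row b2 (shear (e_ a2)) 0 c1 = shear (e_ a2) b2 c1 by rewrite mxE.
  by rewrite BE -!rowE !rE (shear_delta_anti b1) mulr2n opprK.
have wE c : w a b c = spin (e_ a) b c.
  rewrite spin_delta.
  have := tor a b c; have := tor b c a; have := tor c a b.
  have := anti a b c; have := anti b a c; have := anti c a b.
  have := anti a c b; have := anti b c a; have := anti c b a.
  have := shear_delta_anti a c b.
  rewrite !mulr2n; lra.
rewrite -[LHS]mulmx1 -(mul_coframe_frame p) mulmxA; congr (_ *m _).
have rE c : row b (spin (e_ a)) 0 c = spin (e_ a) b c by rewrite mxE.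
by apply/rowP => c; rewrite rE -wE.
Qed.

(** By bilinearity, from the basis fields.  The subtracted term is the derivative
    in the chart of the left-invariant field of coordinates w, which belongs to
    [nabla] but not to its Christoffel part. *)
Lemma christoffel_frame p (u w : G) :
  christoffel D p (u *m frame p) (w *m frame p) =
  w *m spin u *m frame p - w *m shear u.
Proof.
have E a b : christoffel D p (e_ a *m frame p) (e_ b *m frame p) =
    e_ b *m spin (e_ a) *m frame p - e_ b *m shear (e_ a).
  have := nabla_basis_field a b p; rewrite /nabla derive_basis_field.
  by rewrite /basis_field !rowE shear_frame => <-; rewrite addrC addKr.
have step1 a : christoffel D p (e_ a *m frame p) (w *m frame p) =
    w *m spin (e_ a) *m frame p - w *m shear (e_ a).
  rewrite {1}(row_sum_delta w) mulmx_suml; under eq_bigr do rewrite -scalemxAl.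
  rewrite (linear_fun_sum (christoffel_linearr p _)).
  under eq_bigr do rewrite E.
  rewrite [w in RHS](row_sum_delta w) !mulmx_suml -sumrB.
  by apply: eq_bigr => b _; rewrite -!scalemxAl scalerBr.
rewrite {1}(row_sum_delta u) mulmx_suml; under eq_bigr do rewrite -scalemxAl.
rewrite (linear_fun_sum (christoffel_linearl p _)).
under eq_bigr do rewrite step1.
rewrite [u in RHS](row_sum_delta u) !linear_sum /= mulmx_suml -big_split.
by apply: eq_bigr => b _; rewrite !linearZ /= -scalemxAl -scalerDr.
Qed.

End Connection.

(** * Absolutely continuous curves of matrices *)

Section MatrixAbsoluteContinuity.
Variable R : realType.

Definition mx_ac p q (A : R -> 'M[R]_(p, q)) :=
  forall i j, ac01 (fun t => A t i j : R).

Lemma mx_acM p q r (A : R -> 'M[R]_(p, q)) (B : R -> 'M[R]_(q, r)) :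
  mx_ac A -> mx_ac B -> mx_ac (fun t => A t *m B t).
Proof.
move=> acA acB i j; under eq_fun do rewrite mxE.
by apply: (@ac01_sum R R _ _ (fun k t => A t i k * B t k j)) => k; exact: ac01M.
Qed.

Lemma mx_acD p q (A B : R -> 'M[R]_(p, q)) :
  mx_ac A -> mx_ac B -> mx_ac (fun t => A t + B t).
Proof. by move=> acA acB i j; under eq_fun do rewrite mxE; exact: ac01D (acA i j) (acB i j). Qed.

Lemma mx_ac_cst p q (A : 'M[R]_(p, q)) : mx_ac (fun=> A).
Proof. by move=> i j; exact: ac01_cst. Qed.

Lemma mx_acN p q (A : R -> 'M[R]_(p, q)) : mx_ac A -> mx_ac (fun t => - A t).
Proof.
move=> acA; have := mx_acM (mx_ac_cst (- 1%:M)) acA.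
by under eq_fun do rewrite mulNmx mul1mx.
Qed.

Lemma mx_ac_trmx p q (A : R -> 'M[R]_(p, q)) : mx_ac A -> mx_ac (fun t => (A t)^T).
Proof. by move=> acA i j; under eq_fun do rewrite mxE; exact: acA. Qed.

Lemma mx_ac_linear N p q (f : {linear 'rV[R]_N -> 'M[R]_(p, q)}) c :
  mx_ac c -> mx_ac (fun t => f (c t)).
Proof.
move=> acc i j.
have -> : (fun t => f (c t) i j) =
    (fun t => \sum_k c t 0 k * f (delta_mx 0 k) i j).
  apply/funext => t; rewrite {1}[c t]row_sum_delta linear_sum summxE.
  by apply: eq_bigr => k _; rewrite linearZ mxE.
apply: (@ac01_sum R R _ _ (fun k t => c t 0 k * f (delta_mx 0 k) i j)) => k.
by apply: ac01M => //; exact: ac01_cst.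
Qed.

Lemma mx_ac_rV N (c : R -> 'rV[R]_N) : mx_ac c <-> abs_continuous01 c.
Proof.
split=> [acc|acc i j]; last by rewrite [i]ord1; exact: ac01_coord.
suff : ac01 (fun t => \sum_k c t 0 k *: (delta_mx 0 k : 'rV[R]_N)).
  by under eq_fun do rewrite -row_sum_delta.
apply: (@ac01_sum R _ _ _ (fun k t => c t 0 k *: (delta_mx 0 k : 'rV[R]_N))) => k.
have acck := acc 0 k; move=> e e0.
pose M := `|(delta_mx 0 k : 'rV[R]_N)| + 1.
have M0 : 0 < M by rewrite ltr_wpDl.
have [d d0 H] := acck (e / M) (divr_gt0 e0 M0); exists d => // l a b ab tr sd.
have := H _ _ _ ab tr sd; rewrite ltr_pdivlMr //; apply: le_lt_trans.
rewrite mulr_suml; apply: ler_sum => i _; rewrite -scalerBl normrZ.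
by apply: ler_wpM2l => //; rewrite lerDl.
Qed.

Lemma ac01_prod I (r : seq I) (F : I -> R -> R) :
  (forall i, ac01 (F i)) -> ac01 (fun t => \prod_(i <- r) F i t).
Proof.
move=> acF; elim: r => [|i r IH].
  by under eq_fun do rewrite big_nil; exact: ac01_cst.
under eq_fun do rewrite big_cons.
exact: ac01M (acF i) IH.
Qed.

Lemma ac01_det p (A : R -> 'M[R]_p) : mx_ac A -> ac01 (fun t => \det (A t)).
Proof.
move=> acA; rewrite /determinant.
apply: (@ac01_sum R R _ _ (fun (s : {perm 'I_p}) t => (-1) ^+ s * \prod_i A t i (s i))) => s.
apply: ac01M; first exact: ac01_cst.
by apply: (@ac01_prod _ _ (fun i t => A t i (s i))) => i; exact: acA.
Qed.

Lemma row_norm_eq0 p (d : 'rV[R]_p) : d *m d^T = 0 -> d = 0.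
Proof.
move=> E; apply/rowP => i; rewrite [RHS]mxE; apply/eqP.
rewrite -sqrf_eq0 eq_le sqr_ge0 andbT.
have <- : (d *m d^T) 0 0 = 0 by rewrite E mxE.
rewrite mxE (bigD1 i) //= mxE -expr2 lerDl; apply: sumr_ge0 => j _.
by rewrite mxE -expr2 sqr_ge0.
Qed.

Lemma mulmx_trE p q (A B : 'M[R]_(p, q)) i j :
  (A *m B^T) i j = (row i A *m (row j B)^T) 0 0.
Proof. by rewrite !mxE; apply: eq_bigr => k _; rewrite !mxE. Qed.

Lemma orthogonal_det p (A : 'M[R]_p) : A *m A^T = 1%:M ->
  \det A = 1 \/ \det A = -1.
Proof.
move=> AA; have : \det A ^+ 2 = 1.
  by rewrite expr2 -{2}det_tr -det_mulmx AA det1.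
by move=> /eqP; rewrite sqrf_eq1 => /orP[] /eqP; [left|right].
Qed.

(** The determinant is continuous with values 1 and -1. *)
Lemma orthogonal_path_det p (A : R -> 'M[R]_p) : mx_ac A ->
  (forall t, 0 <= t <= 1 -> A t *m (A t)^T = 1%:M) -> \det (A 0) = 1 ->
  \det (A 1) = 1.
Proof.
move=> acA orth d0; have [//|d1] : \det (A 1) = 1 \/ \det (A 1) = -1.
  by apply: orthogonal_det; apply: orth; lra.
have cd := ac01_continuous (ac01_det acA).
have [|t] := IVT ler01 cd (v := 0).
  by rewrite d0 d1; case: (leP (1 : R) (-1)) => ?; lra.
rewrite in_itv /= => t01 dt.
by case: (orthogonal_det (orth _ t01)); rewrite dt; lra.
Qed.

End MatrixAbsoluteContinuity.

(** * Parallel transport is a rotation *)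

Section Transport.
Variables (R : realType) (m : nat).
Local Notation N := (m + npairs m)%N.
Local Notation G := 'rV[R]_N.
Variable D : connection R N.
Hypothesis hD : levi_civita (carnot_metric R m) D.

Definition coords (c V : R -> G) (t : R) : G := V t *m coframe (c t).

(** The parallel equation becomes a linear equation with skew coefficients. *)
Lemma coords_derive c V t c' V' : mx_derive c t c' -> mx_derive V t V' ->
  V' + christoffel D (c t) c' (V t) = 0 ->
  mx_derive (coords c V) t (- (coords c V t *m spin (c' *m coframe (c t)))).
Proof.
move=> dc dV par.
have dco : mx_derive (fun s => coframe (c s)) t (- shear c').
  rewrite -sub0r; apply: mx_deriveB; first exact: mx_derive_cst.
  exact: mx_derive_linear.
have := mx_deriveM dV dco; rewrite -/(coords c V).
set b := c' *m coframe (c t); set a := coords c V t.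
have c'E : c' = b *m frame (c t) by rewrite -mulmxA mul_coframe_frame mulmx1.
have VE : V t = a *m frame (c t) by rewrite -mulmxA mul_coframe_frame mulmx1.
move: par; rewrite {1}VE {1}c'E christoffel_frame // => /eqP.
rewrite addr_eq0 opprB => /eqP ->.
rewrite c'E shear_frame mulmxBl -[_ *m frame _ *m coframe _]mulmxA.
rewrite mul_frame_coframe mulmx1 VE mulmxN -[a *m frame _ *m _]mulmxA.
rewrite [coframe _]/coframe mulmxBr mulmx1 -[_ *m shear _ *m shear _]mulmxA.
rewrite mul_shear_shear mulmx0 subr0 frameE mulmxDl mul1mx mul_shear_shear addr0.
by rewrite addrAC subrr add0r.
Qed.

Lemma coords_ac c V : mx_ac c -> mx_ac V -> mx_ac (coords c V).
Proof.
move=> acc acV; apply: mx_acM => //.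
apply: mx_acD; first exact: mx_ac_cst.
by apply: mx_acN; exact: mx_ac_linear.
Qed.

(** The derivatives of the two factors cancel because [spin] is skew. *)
Lemma parallel_isometry c V W : mx_ac c ->
  parallel_along D c V -> parallel_along D c W -> forall t, 0 <= t <= 1 ->
  coords c V t *m (coords c W t)^T = coords c V 0 *m (coords c W 0)^T.
Proof.
move=> acc [/mx_ac_rV acV pV] [/mx_ac_rV acW pW] t t01.
apply/matrixP => i j.
apply: (@ac01_derive0 R (fun s => (coords c V s *m (coords c W s)^T) i j)) => //.
  by apply: mx_acM; [|apply: mx_ac_trmx]; exact: coords_ac.
apply: negligibleS (negligibleU pV pW) => s /= nP.
apply/not_andP => -[HV HW]; apply: nP => s01.
have [dc dV eV] := HV s01; have [_ dW eW] := HW s01.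
have /mx_derive_rV mc : derivable c s 1 /\ 'D_1 c s = 'D_1 c s by [].
have /mx_derive_rV mV : derivable V s 1 /\ 'D_1 V s = 'D_1 V s by [].
have /mx_derive_rV mW : derivable W s 1 /\ 'D_1 W s = 'D_1 W s by [].
have := mx_deriveM (coords_derive mc mV eV) (mx_derive_trmx (coords_derive mc mW eW)).
set S := spin _.
have ST : S^T = - S by exact: spin_anti.
have -> : - (coords c V s *m S) *m (coords c W s)^T +
   coords c V s *m (- (coords c W s *m S))^T = 0.
  by rewrite [(- _)^T]linearN /= [(_ *m S)^T]trmx_mul ST !mulNmx opprK mulmxA addNr.
by move=> /(_ i j); rewrite mxE.
Qed.

(** The squared distance of two parallel fields is a combination of their inner
    products, hence constant: no estimate on the coefficients of the equation is
    needed. *)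
Lemma parallel_unique c V W : mx_ac c -> parallel_along D c V ->
  parallel_along D c W -> V 0 = W 0 -> V 1 = W 1.
Proof.
move=> acc pV pW VW0.
have C0 : coords c V 0 = coords c W 0 by rewrite /coords VW0.
have t1 : 0 <= (1 : R) <= 1 by lra.
have VV := parallel_isometry acc pV pV t1.
have VW := parallel_isometry acc pV pW t1.
have WV := parallel_isometry acc pW pV t1.
have WW := parallel_isometry acc pW pW t1.
have E : (coords c V 1 - coords c W 1) *m (coords c V 1 - coords c W 1)^T = 0.
  move: VV VW WV WW; rewrite C0.
  move: (coords c V 1) (coords c W 1) (coords c W 0) => a b d VV VW WV WW.
  by rewrite [(_ - _)^T]linearB /= mulmxBl !mulmxBr VV VW WV WW !subrr.
have /eqP := row_norm_eq0 E; rewrite subr_eq0 => /eqP.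
move=> /(congr1 (mulmx^~ (frame (c 1)))).
by rewrite /= -!mulmxA mul_coframe_frame !mulmx1.
Qed.

(** The frame coordinates of the parallel fields issued from the frame at c 0 form
    a path of orthogonal matrices that starts at the identity. *)
Lemma transport_SO c P : abs_continuous01 c -> parallel_transport D c P ->
  SO R N (frame (c 0) *m P *m coframe (c 1)).
Proof.
move=> /mx_ac_rV acc tr.
have /choice [V HV] : forall i : 'I_N, exists V, [/\ parallel_along D c V,
    V 0 = row i (frame (c 0)) & V 1 = row i (frame (c 0)) *m P].
  by move=> i; apply/tr.
have [A rA] : exists A : R -> 'M[R]_N, forall t i, row i (A t) = coords c (V i) t.
  exists (fun t => \matrix_i coords c (V i) t) => t i; exact: rowK.
have A0 : A 0 = 1%:M.
  apply/row_matrixP => i; rewrite rA /coords; have [_ -> _] := HV i.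
  by rewrite -row_mul mul_frame_coframe.
have A1 : A 1 = frame (c 0) *m P *m coframe (c 1).
  apply/row_matrixP => i; rewrite rA /coords; have [_ _ ->] := HV i.
  by rewrite -!row_mul.
have acA : mx_ac A.
  move=> i j; have [[/mx_ac_rV acV _] _ _] := HV i.
  have -> : (fun t => A t i j) = (fun t => coords c (V i) t 0 j).
    by apply/funext => t; rewrite -rA mxE.
  exact: coords_ac.
have orth t : 0 <= t <= 1 -> A t *m (A t)^T = 1%:M.
  move=> t01; rewrite -[RHS](mulmx1 1%:M) -{2}trmx1 -A0.
  apply/matrixP => i j; rewrite mulmx_trE [RHS]mulmx_trE !rA.
  have [pi _ _] := HV i; have [pj _ _] := HV j.
  by rewrite (parallel_isometry acc pi pj t01).
rewrite -A1; split; first by apply: orth; lra.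
by apply: orthogonal_path_det acA orth _; rewrite A0 det1.
Qed.

End Transport.

(** * Lipschitz curves *)

Section Lipschitz.
Variable R : realType.
Implicit Types f g : R -> R.

Definition lip01 f := exists2 K : R, 0 <= K &
  forall s t : R, 0 <= s -> s <= t -> t <= 1 -> `|f t - f s| <= K * (t - s).

Lemma lip01_ac f : lip01 f -> ac01 f.
Proof. by move=> [K _ fK]; exact: ac01_lipschitz fK. Qed.

Lemma lip01_cst (k : R) : lip01 (fun=> k).
Proof. by exists 0 => // *; rewrite subrr normr0 mul0r. Qed.

Lemma lip01D f g : lip01 f -> lip01 g -> lip01 (fun t => f t + g t).
Proof.
move=> [K K0 fK] [L L0 gL]; exists (K + L); first exact: addr_ge0.
move=> s t s0 st t1; rewrite mulrDl opprD addrACA.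
by apply: le_trans (ler_normD _ _) _; apply: lerD; [exact: fK | exact: gL].
Qed.

Lemma lip01Z k f : lip01 f -> lip01 (fun t => k * f t).
Proof.
move=> [K K0 fK]; exists (`|k| * K); first exact: mulr_ge0.
move=> s t s0 st t1; rewrite -mulrBr normrM -mulrA.
by apply: ler_wpM2l => //; exact: fK.
Qed.

Lemma lip01_sum I (r : seq I) (F : I -> R -> R) :
  (forall i, lip01 (F i)) -> lip01 (fun t => \sum_(i <- r) F i t).
Proof.
move=> lF; elim: r => [|i r IH].
  by under eq_fun do rewrite big_nil; exact: lip01_cst.
under eq_fun do rewrite big_cons.
exact: lip01D (lF i) IH.
Qed.

Lemma lip01_derive f (df : R -> R) (K : R) : (forall t : R, is_derive t 1 f (df t)) ->
  (forall t, `|df t| <= K) -> lip01 f.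
Proof.
move=> fdf dK; have K0 : 0 <= K by exact: le_trans (dK 0).
exists K => // s t s0 st t1.
have [|z _ ->] := MVT_segment st (fun x _ => fdf x).
  apply: continuous_subspaceT => z; apply: differentiable_continuous.
  by apply/derivable1_diffP; exact: ex_derive.
by rewrite normrM (ger0_norm (_ : 0 <= t - s)) ?subr_ge0 // ler_wpM2r ?subr_ge0.
Qed.

Definition glue T (f g : R -> T) (t : R) : T :=
  if t <= 2^-1 then f (2 * t) else g (2 * t - 1).

Lemma glue0 T (f g : R -> T) : glue f g 0 = f 0.
Proof. by rewrite /glue mulr0 ifT // invr_ge0. Qed.

Lemma glue1 T (f g : R -> T) : glue f g 1 = g 1.
Proof.
rewrite /glue ifF; first by congr g; ring.
by apply/negbTE; rewrite -ltNge; lra.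
Qed.

Lemma glue_lip f g : lip01 f -> lip01 g -> f 1 = g 0 -> lip01 (glue f g).
Proof.
move=> [K K0 fK] [L L0 gL] fg; exists ((K + L) * 2).
  by rewrite mulr_ge0 ?addr_ge0.
move=> s t s0 st t1; rewrite /glue -mulrA [(K + L) * _]mulrDl.
have d0 : 0 <= 2 * (t - s) by lra.
have [t2|t2] := leP t 2^-1.
  have -> : s <= 2^-1 by lra.
  have := fK (2 * s) (2 * t); rewrite -mulrBr => /(_ ltac:(lra) ltac:(lra) ltac:(lra)).
  by have := mulr_ge0 L0 d0; lra.
have [s2|s2] := leP s 2^-1.
  have := fK (2 * s) 1 ltac:(lra) ltac:(lra) ltac:(lra).
  have := gL 0 (2 * t - 1) ltac:(lra) ltac:(lra) ltac:(lra).
  rewrite -fg => hg hf.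
  have := ler_normD (g (2 * t - 1) - f 1) (f 1 - f (2 * s)); rewrite addrA subrK => hn.
  have : K * (1 - 2 * s) <= K * (2 * (t - s)) by apply: ler_wpM2l => //; lra.
  have : L * (2 * t - 1 - 0) <= L * (2 * (t - s)) by apply: ler_wpM2l => //; lra.
  lra.
have := gL (2 * s - 1) (2 * t - 1) ltac:(lra) ltac:(lra) ltac:(lra).
rewrite (_ : 2 * t - 1 - (2 * s - 1) = 2 * (t - s)); last ring.
by have := mulr_ge0 K0 d0; lra.
Qed.

Lemma is_derive_affine (f : R -> R) (k b t df : R) :
  is_derive (k * t + b) 1 f df -> is_derive t 1 (fun s => f (k * s + b)) (k * df).
Proof.
move=> d; have da : is_derive t 1 (fun s => k * s + b) k.
  by apply: is_derive_eq; rewrite /GRing.scale /= ?(mulr1, mulr0, addr0, add0r).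
by rewrite mulrC; exact: (@is_derive1_comp _ f (fun s => k * s + b)).
Qed.

Definition mx_lip p q (A : R -> 'M[R]_(p, q)) := forall i j, lip01 (fun t => A t i j).

Lemma mx_lip_ac p q (A : R -> 'M[R]_(p, q)) : mx_lip A -> mx_ac A.
Proof. by move=> lA i j; exact: lip01_ac. Qed.

Lemma mx_lip_mull p q r (B : 'M[R]_(p, q)) (A : R -> 'M[R]_(q, r)) :
  mx_lip A -> mx_lip (fun t => B *m A t).
Proof.
move=> lA i j; under eq_fun do rewrite mxE.
by apply: (@lip01_sum _ _ (fun k t => B i k * A t k j)) => k; exact: lip01Z.
Qed.

Lemma mx_glue_lip p q (A B : R -> 'M[R]_(p, q)) :
  mx_lip A -> mx_lip B -> A 1 = B 0 -> mx_lip (glue A B).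
Proof.
move=> lA lB AB i j.
have -> : (fun t => glue A B t i j) = glue (fun t => A t i j) (fun t => B t i j).
  by apply/funext => t; rewrite /glue; case: ifP.
by apply: glue_lip => //; rewrite AB.
Qed.

Lemma glue_derive_l p q (A B : R -> 'M[R]_(p, q)) t A' : t < 2^-1 ->
  mx_derive A (2 * t) A' -> mx_derive (glue A B) t (2 *: A').
Proof.
move=> t2 dA i j; rewrite mxE.
apply: (@near_eq_is_derive R R R (fun s : R => A (2 * s + 0) i j : R)).
  near=> s; rewrite /glue addr0 ifT //; apply: ltW.
  by near: s; exact: lt_nbhsl.
apply: (@is_derive_affine (fun s => A s i j)); rewrite addr0; exact: dA.
Unshelve. all: by end_near. Qed.

Lemma glue_derive_r p q (A B : R -> 'M[R]_(p, q)) t B' : 2^-1 < t ->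
  mx_derive B (2 * t - 1) B' -> mx_derive (glue A B) t (2 *: B').
Proof.
move=> t2 dB i j; rewrite mxE.
apply: (@near_eq_is_derive R R R (fun s : R => B (2 * s - 1) i j : R)).
  near=> s; rewrite /glue ifF //; apply/negbTE; rewrite -ltNge.
  by near: s; exact: lt_nbhsr.
apply: (@is_derive_affine (fun s => B s i j)); exact: dB.
Unshelve. all: by end_near. Qed.

Lemma negligible_seq (s : seq R) : (@lebesgue_measure R).-negligible [set` s].
Proof.
have cs : countable [set` s] by apply: finite_set_countable; exact: finite_seq.
exists [set` s]; split=> //; last exact: countable_lebesgue_measure0.
by apply: countable_measurable cs => t; exact: measurable_set1.
Qed.

End Lipschitz.

(** * Paths with explicit transport and their concatenation *)

Section Steering.
Variables (R : realType) (m : nat).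
Local Notation N := (m + npairs m)%N.
Local Notation G := 'rV[R]_N.
Implicit Types (x y z u : G) (Q : 'M[R]_N).

(** The parallel equation of [coords_derive], for a matrix of solutions. *)
Definition steers (c : R -> G) (A : R -> 'M[R]_N) (t : R) := exists u,
  mx_derive c t (u *m frame (c t)) /\ mx_derive A t (- (A t *m spin u)).

(** Some path from x to y has transport Q, as a matrix from the frame at x to the
    frame at y.  Demanding Lipschitz curves and a finite set of exceptional times,
    rather than absolute continuity and a null set, leaves enough paths and makes
    concatenation elementary. *)
Definition steer x y Q := exists c A (s : seq R),
  [/\ mx_lip c /\ mx_lip A, c 0 = x /\ c 1 = y, A 0 = 1%:M /\ A 1 = Q
    & forall t, 0 <= t <= 1 -> t \notin s -> steers c A t].

Lemma steer_trans x y z Q Q' : steer x y Q -> steer y z Q' -> steer x z (Q *m Q').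
Proof.
move=> [c [A [s [[lc lA] [cx cy] [A0 A1] H]]]].
move=> [c' [A' [s' [[lc' lA'] [cy' cz] [A0' A1'] H']]]].
exists (glue c c'), (glue A (fun t => Q *m A' t)).
exists (2^-1 :: [seq r / 2 | r <- s] ++ [seq (r + 1) / 2 | r <- s']); split.
- split; first by apply: mx_glue_lip => //; rewrite cy.
  by apply: mx_glue_lip => //; [exact: mx_lip_mull | rewrite A1 A0' mulmx1].
- by rewrite glue0 glue1.
- by rewrite glue0 glue1 A1'.
- move=> t t01; rewrite inE negb_or mem_cat negb_or => /and3P[t2 ts ts'].
  have [tlt|tgt|te] := ltgtP t 2^-1; last by rewrite te eqxx in t2.
  + have [||u [dc dA]] := H (2 * t); first lra.
      apply: contra ts => ts; apply/mapP; exists (2 * t) => //; lra.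
    have gt T (f g : R -> T) : glue f g t = f (2 * t) by rewrite /glue ifT // ltW.
    exists (2 *: u); rewrite !gt; split.
      by rewrite -scalemxAl; exact: glue_derive_l.
    by rewrite linearZ /= -scalemxAr -scalerN; exact: glue_derive_l.
  + have [||u [dc dA]] := H' (2 * t - 1); first lra.
      apply: contra ts' => ts'; apply/mapP; exists (2 * t - 1) => //; lra.
    have gt T (f g : R -> T) : glue f g t = g (2 * t - 1).
      by rewrite /glue ifF //; apply/negbTE; rewrite -ltNge.
    exists (2 *: u); rewrite !gt; split.
      by rewrite -scalemxAl; exact: glue_derive_r.
    rewrite linearZ /= -scalemxAr -scalerN; apply: glue_derive_r => //.
    have := mx_deriveM (mx_derive_cst Q (2 * t - 1)) dA.
    by rewrite mul0mx add0r mulmxN mulmxA.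
Qed.

(** A straight segment from x is an integral curve of a left-invariant field: the
    frame coordinates u of its velocity are constant because the bracket of u with
    itself vanishes. *)
Lemma steer_line x u (A : R -> 'M[R]_N) : mx_lip A -> A 0 = 1%:M ->
  (forall t, mx_derive A t (- (A t *m spin u))) ->
  steer x (x + u *m frame x) (A 1).
Proof.
move=> lA A0 dA; exists (fun t => x + t *: (u *m frame x)), A, [::]; split=> //.
- split=> // i j; under eq_fun do rewrite mxE [X in _ + X]mxE mulrC.
  apply: lip01D; first exact: lip01_cst.
  by apply: lip01Z; exists 1 => // s t _ st _; rewrite mul1r ger0_norm ?subr_ge0.
- by rewrite scale0r addr0 scale1r.
- move=> t _ _; exists u; split=> //.
  have -> : u *m frame (x + t *: (u *m frame x)) = 0 + u *m frame x.
    rewrite [frame (x + _)]frameE shearD shearZ shear_frame addrA -frameE.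
    rewrite mulmxDr -scalemxAr.
    by rewrite mul_shear_self scaler0 addr0 add0r.
  apply: mx_deriveD; first exact: mx_derive_cst.
  move=> i j; under eq_fun do rewrite mxE.
  by apply: is_derive_eq; rewrite /GRing.scale /= ?(mulr1, mulr0, addr0, add0r).
Qed.

Variable D : connection R N.
Hypothesis hD : levi_civita (carnot_metric R m) D.

(** The curve [u *m coframe x *m A t *m frame (c t)] is an explicit parallel field,
    and [parallel_unique] says that there is no other. *)
Lemma steer_transport x y Q : steer x y Q -> exists c,
  [/\ abs_continuous01 c, c 0 = x, c 1 = y
    & parallel_transport D c (coframe x *m Q *m frame y)].
Proof.
move=> [c [A [s [[lc lA] [cx cy] [A0 A1] H]]]]; exists c.
have acc : mx_ac c by exact: mx_lip_ac.
split=> //; first exact/mx_ac_rV.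
move=> u w; pose V t := u *m coframe x *m A t *m frame (c t).
have V0 : V 0 = u by rewrite /V A0 cx mulmx1 -mulmxA mul_coframe_frame mulmx1.
have V1 : V 1 = u *m (coframe x *m Q *m frame y) by rewrite /V A1 cy !mulmxA.
have FE : (fun t => frame (c t)) = (fun t => 1%:M + shear (c t)).
  by apply/funext => t; exact: frameE.
have pV : parallel_along D c V.
  split.
    apply/mx_ac_rV; apply: mx_acM.
      by apply: mx_acM; [exact: mx_ac_cst | exact: mx_lip_ac].
    rewrite FE.
    by apply: mx_acD; [exact: mx_ac_cst | exact: mx_ac_linear].
  apply: negligibleS (negligible_seq s) => t /= nP.
  apply: contrapT => /negP ts; apply: nP => t01.
  have [b [dc dA]] := H t t01 ts.
  have dF : mx_derive (fun r => frame (c r)) t (shear b).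
    rewrite FE -[shear b]add0r; apply: mx_deriveD; first exact: mx_derive_cst.
    by rewrite -(shear_frame b (c t)); exact: mx_derive_linear.
  have dV := mx_deriveM (mx_deriveM (mx_derive_cst (u *m coframe x) t) dA) dF.
  have [ec dce] := (mx_derive_rV _ _ _).1 dc.
  have [eV dVe] := (mx_derive_rV _ _ _).1 dV.
  split=> //; rewrite dVe dce /V christoffel_frame // mul0mx add0r.
  by rewrite mulmxN mulNmx !mulmxA addrACA addNr subrr addr0.
split=> [uw|[W [pW W0 W1]]]; first by exists V; rewrite V1.
by rewrite -V1 -W1; apply: (parallel_unique hD acc pV pW); rewrite V0 W0.
Qed.

End Steering.

(** * Rotations of coordinate planes generate SO *)

Section Rotations.
Variables (R : realType) (N : nat).
Local Notation e_ i := (delta_mx 0 i : 'rV[R]_N).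
Implicit Types (J A B Q : 'M[R]_N) (u v w : 'rV[R]_N) (i j k : 'I_N).

(** Rodrigues' formula: this is the exponential of t J as soon as J^3 = - J. *)
Definition turn J (t : R) : 'M[R]_N :=
  1%:M + sin t *: J + (1 - cos t) *: (J *m J).

Lemma turn0 J : turn J 0 = 1%:M.
Proof. by rewrite /turn sin0 cos0 subrr !scale0r !addr0. Qed.

Lemma turnN J t : turn (- J) t = turn J (- t).
Proof. by rewrite /turn sinN cosN mulmxN mulNmx opprK scalerN scaleNr. Qed.

Lemma turn_trmx J t : J^T = - J -> (turn J t)^T = turn J (- t).
Proof.
move=> JT; rewrite /turn !linearD /= !linearZ /= trmx1 trmx_mul JT.
by rewrite mulmxN mulNmx opprK sinN cosN scaleNr scalerN.
Qed.

Lemma turnD J a b : J *m J *m J = - J -> turn J a *m turn J b = turn J (a + b).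
Proof.
move=> J3; have J3' : J *m (J *m J) = - J by rewrite mulmxA.
have J4 : J *m J *m (J *m J) = - (J *m J) by rewrite mulmxA J3 mulNmx.
rewrite /turn sinD cosD !mulmxDl !mulmxDr !mul1mx !mulmx1.
rewrite -!scalemxAl -!scalemxAr J3 J3' J4.
move: (J *m J) => K.
by apply/matrixP => i j; rewrite !mxE; ring.
Qed.

Lemma is_derive_turn_entry (k a b d t : R) :
  is_derive t 1 (fun s : R => a + sin (k * s) * b + (1 - cos (k * s)) * d)
    (k * (cos (k * t) * b + sin (k * t) * d)).
Proof.
have comb (f g : R -> R) (f' g' : R) : is_derive t 1 f f' -> is_derive t 1 g g' ->
    is_derive t 1 (fun s => a + f s * b + (1 - g s) * d) (f' * b - g' * d).
  move=> df dg; have -> : (fun s => a + f s * b + (1 - g s) * d) =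
    cst (a + d) + f * cst b - g * cst d.
    by apply/funext => s; rewrite !fctE; ring.
  have d1 := is_deriveM df (is_derive_cst b t 1).
  have d2 := is_deriveM dg (is_derive_cst d t 1).
  apply: (is_derive_eq (is_deriveB (is_deriveD (is_derive_cst (a + d) t 1) d1) d2)).
  by rewrite /GRing.scale /= !mulr0 !add0r ![_ * f']mulrC ![_ * g']mulrC.
have ds : is_derive t 1 (fun s => sin (k * s + 0)) (k * cos (k * t + 0)).
  exact: is_derive_affine.
have dc : is_derive t 1 (fun s => cos (k * s + 0)) (k * - sin (k * t + 0)).
  exact: is_derive_affine.
have := comb _ _ _ _ ds dc; rewrite addr0.
rewrite mulrN mulNr opprK -!mulrA -mulrDr.
by under eq_fun do rewrite addr0.
Qed.

(** Hence [turn J] solves the parallel equation in direction of a generator J. *)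
Lemma turn_derive J (k t : R) : J *m J *m J = - J ->
  mx_derive (fun s => turn J (k * s)) t (k *: (turn J (k * t) *m J)).
Proof.
move=> J3.
have -> : turn J (k * t) *m J = cos (k * t) *: J + sin (k * t) *: (J *m J).
  rewrite /turn !mulmxDl mul1mx -!scalemxAl J3 scalerN scalerBl scale1r opprB.
  by rewrite addrAC addrCA subrr addr0 addrC.
rewrite /turn; move: (J *m J) => K i j.
have -> : (fun s => (1%:M + sin (k * s) *: J + (1 - cos (k * s)) *: K) i j) =
    (fun s => (1%:M : 'M[R]_N) i j + sin (k * s) * J i j + (1 - cos (k * s)) * K i j).
  by apply/funext => s; rewrite !mxE.
have -> : (k *: (cos (k * t) *: J + sin (k * t) *: K)) i j =
    k * (cos (k * t) * J i j + sin (k * t) * K i j) by rewrite !mxE.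
exact: is_derive_turn_entry.
Qed.

Lemma turn_lip J (k : R) : mx_lip (fun s => turn J (k * s)).
Proof.
move=> i j; rewrite /turn; move: (J *m J) => K.
have ls : lip01 (fun s => sin (k * s + 0)).
  apply: (@lip01_derive _ _ (fun s => k * cos (k * s + 0)) `|k|) => s.
    exact: is_derive_affine.
  by rewrite normrM ler_piMr // cos_max.
have lc : lip01 (fun s => cos (k * s + 0)).
  apply: (@lip01_derive _ _ (fun s => k * - sin (k * s + 0)) `|k|) => s.
    exact: is_derive_affine.
  by rewrite normrM normrN ler_piMr // sin_max.
have -> : (fun s => (1%:M + sin (k * s) *: J + (1 - cos (k * s)) *: K) i j) =
    (fun s => ((1%:M : 'M[R]_N) i j + K i j) +
      (J i j * sin (k * s + 0) + (- K i j) * cos (k * s + 0))).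
  by apply/funext => s; rewrite !mxE addr0; ring.
by apply: lip01D; [exact: lip01_cst | apply: lip01D; exact: lip01Z].
Qed.

Lemma turn_orthogonal J t : J *m J *m J = - J -> J^T = - J ->
  turn J t *m (turn J t)^T = 1%:M.
Proof. by move=> J3 JT; rewrite turn_trmx // turnD // subrr turn0. Qed.

(** A turn is the square of the turn of half the angle, whose determinant is 1 or
    -1. *)
Lemma turn_det J t : J *m J *m J = - J -> J^T = - J -> \det (turn J t) = 1.
Proof.
move=> J3 JT; have -> : t = t / 2 + t / 2 by lra.
rewrite -turnD // det_mulmx.
have [->|->] := orthogonal_det (turn_orthogonal (t / 2) J3 JT); ring.
Qed.

Lemma turn_conj J Q t : Q *m Q^T = 1%:M ->
  Q^T *m turn J t *m Q = turn (Q^T *m J *m Q) t.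
Proof.
move=> QQ; have QQ' : Q^T *m Q = 1%:M by exact: mulmx1C.
rewrite /turn !mulmxDr !mulmxDl mulmx1 QQ' -!scalemxAr -!scalemxAl.
by congr (_ + _ + _ *: _); rewrite -!mulmxA [Q *m (Q^T *m _)]mulmxA QQ mul1mx.
Qed.

(** The infinitesimal rotation of the plane spanned by u and v. *)
Definition plane u v : 'M[R]_N := u^T *m v - v^T *m u.

Lemma plane_anti u v : plane v u = - plane u v.
Proof. by rewrite /plane opprB. Qed.

Lemma plane_trmx u v : (plane u v)^T = - plane u v.
Proof. by rewrite /plane linearB /= !trmx_mul !trmxK opprB. Qed.

Lemma planeNl u v : plane (- u) v = - plane u v.
Proof. by rewrite /plane linearN /= mulNmx mulmxN -opprB opprK addrC. Qed.

Lemma plane_conj Q u v : Q^T *m plane u v *m Q = plane (u *m Q) (v *m Q).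
Proof. by rewrite /plane mulmxBr mulmxBl !trmx_mul !mulmxA. Qed.

Lemma mul_delta_trmx i j : e_ i *m (e_ j)^T = (i == j)%:R%:M.
Proof.
rewrite trmx_delta mul_delta_mx_cond; case: (i == j).
  by rewrite mulr1n; apply/matrixP => a b; rewrite !ord1 !mxE.
by rewrite mulr0n raddf0.
Qed.

Lemma mul_delta_plane k i j : e_ k *m plane (e_ i) (e_ j) =
  (k == i)%:R *: e_ j - (k == j)%:R *: e_ i.
Proof.
by rewrite /plane mulmxBr !mulmxA !mul_delta_trmx !mul_scalar_mx.
Qed.

Lemma plane_cube i j : i != j -> let J := plane (e_ i) (e_ j) in
  J *m J *m J = - J.
Proof.
move=> ij J; have ji : (j == i) = false by rewrite eq_sym (negbTE ij).
have Ji : e_ i *m J = e_ j.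
  by rewrite mul_delta_plane eqxx (negbTE ij) scale1r scale0r subr0.
have Jj : e_ j *m J = - e_ i.
  by rewrite mul_delta_plane eqxx ji scale1r scale0r sub0r.
apply/row_matrixP => k; rewrite !rowE !mulmxA mulmxN.
have [->|ki] := eqVneq k i; first by rewrite Ji Jj mulNmx Ji.
have [->|kj] := eqVneq k j; first by rewrite Jj !mulNmx Ji Jj.
have -> : e_ k *m J = 0.
  by rewrite mul_delta_plane (negbTE ki) (negbTE kj) !scale0r subrr.
by rewrite !mul0mx oppr0.
Qed.

Definition rot i j (t : R) := turn (plane (e_ i) (e_ j)) t.

Lemma rot_sym i j t : rot j i t = rot i j (- t).
Proof. by rewrite /rot plane_anti turnN. Qed.

Lemma delta_rot i j t : i != j ->
  e_ i *m rot i j t = cos t *: e_ i + sin t *: e_ j.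
Proof.
move=> ij; have Ji : e_ i *m plane (e_ i) (e_ j) = e_ j.
  by rewrite mul_delta_plane eqxx (negbTE ij) scale1r scale0r subr0.
have Jj : e_ j *m plane (e_ i) (e_ j) = - e_ i.
  by rewrite mul_delta_plane eqxx eq_sym (negbTE ij) scale1r scale0r sub0r.
rewrite /rot; move: (plane _ _) Ji Jj => J Ji Jj.
rewrite /turn !mulmxDr mulmx1 -!scalemxAr mulmxA.
by rewrite Ji Jj; apply/rowP => a; rewrite !mxE; ring.
Qed.

Lemma delta_rot_id i j k t : k != i -> k != j -> e_ k *m rot i j t = e_ k.
Proof.
move=> ki kj; have : e_ k *m plane (e_ i) (e_ j) = 0.
  by rewrite mul_delta_plane (negbTE ki) (negbTE kj) !scale0r subrr.
rewrite /rot; move: (plane _ _) => J Jk.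
rewrite /turn !mulmxDr mulmx1 -!scalemxAr mulmxA.
by rewrite Jk mul0mx !scaler0 !addr0.
Qed.

Lemma row_rot w i j t : i != j ->
  let w' := w *m rot i j t in
  [/\ w' 0 i = w 0 i * cos t - w 0 j * sin t,
      w' 0 j = w 0 i * sin t + w 0 j * cos t
    & forall k, k != i -> k != j -> w' 0 k = w 0 k].
Proof.
move=> ij w'.
have RT k : w' 0 k = (w *m (e_ k *m rot i j (- t))^T) 0 0.
  rewrite trmx_mul /rot turn_trmx ?plane_trmx // opprK mulmxA trmx_delta.
  by rewrite -colE [RHS]mxE.
have wE k a : (w *m (a *: e_ k)^T) 0 0 = a * w 0 k.
  by rewrite linearZ /= -scalemxAr trmx_delta -colE !mxE.
have ji : j != i by rewrite eq_sym.
split=> [||k ki kj].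
- by rewrite RT delta_rot // linearD /= mulmxDr mxE !wE cosN sinN; ring.
- by rewrite RT -rot_sym delta_rot // linearD /= mulmxDr mxE !wE; ring.
- by rewrite RT delta_rot_id // -[e_ k]scale1r wE mul1r.
Qed.

(** Take t to be minus the polar angle of (x, y). *)
Lemma givens_angle (x y : R) : exists t : R,
  x * sin t + y * cos t = 0 /\ 0 <= x * cos t - y * sin t.
Proof.
pose r := Num.sqrt (x ^+ 2 + y ^+ 2).
have s0 : 0 <= x ^+ 2 + y ^+ 2 by rewrite addr_ge0 ?sqr_ge0.
have r2 : r ^+ 2 = x ^+ 2 + y ^+ 2 by rewrite sqr_sqrtr.
have [r0|rN0] := eqVneq r 0.
  have : x ^+ 2 + y ^+ 2 == 0 by rewrite -r2 r0 expr0n.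
  rewrite paddr_eq0 ?sqr_ge0 // !sqrf_eq0 => /andP[/eqP -> /eqP ->].
  by exists 0; rewrite !mul0r subrr addr0.
have rp : 0 < r by rewrite lt_neqAle eq_sym rN0 sqrtr_ge0.
have xr : -1 <= x / r <= 1.
  rewrite -ler_norml normrM normfV (gtr0_norm rp) ler_pdivrMr // mul1r.
  by rewrite -sqrtr_sqr ler_wsqrtr // lerDl sqr_ge0.
have cE : cos (acos (x / r)) = x / r by rewrite acosK // in_itv.
have sE : sin (acos (x / r)) = `|y| / r.
  rewrite sin_acos // -[`|y| / r]ger0_norm ?divr_ge0 ?(ltW rp) //.
  rewrite -sqrtr_sqr !expr_div_n real_normK ?num_real // r2.
  congr Num.sqrt; have : x ^+ 2 + y ^+ 2 != 0 by rewrite -r2 expf_neq0.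
  by move=> h; field.
have pos : 0 <= r^-1 * (x ^+ 2 + y ^+ 2) by rewrite mulr_ge0 // invr_ge0 ltW.
have [y0|y0] := leP y 0.
  exists (acos (x / r)); rewrite cE sE ler0_norm //; split; first by ring.
  by apply: le_trans pos _; rewrite le_eqVlt; apply/orP; left; apply/eqP; ring.
exists (- acos (x / r)); rewrite cosN sinN cE sE gtr0_norm //; split; first by ring.
by apply: le_trans pos _; rewrite le_eqVlt; apply/orP; left; apply/eqP; ring.
Qed.

Section Generation.
Variable H : set 'M[R]_N.
Hypothesis H1 : H 1%:M.
Hypothesis HM : forall A B, H A -> H B -> H (A *m B).
Hypothesis Hrot : forall i j t, i != j -> H (rot i j t).

(** The condition bears on the transpose because elimination will produce Q with
    A *m Q = 1, that is A = Q^T. *)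
Let K Q := [/\ H Q^T, Q *m Q^T = 1%:M & \det Q = 1].

Let K1 : K 1%:M.
Proof. by rewrite /K trmx1 mulmx1 det1. Qed.

Let KM A B : K A -> K B -> K (A *m B).
Proof.
move=> [hA oA dA] [hB oB dB]; split; first by rewrite trmx_mul; exact: HM.
  by rewrite trmx_mul mulmxA -[A *m B *m _]mulmxA oB mulmx1.
by rewrite det_mulmx dA dB mulr1.
Qed.

Let Krot i j t : i != j -> K (rot i j t).
Proof.
move=> ij; have J3 := plane_cube ij; have JT := plane_trmx (e_ i) (e_ j).
split; last exact: turn_det.
  by rewrite /rot turn_trmx //; exact: Hrot.
exact: turn_orthogonal.
Qed.

(** Rotations in the planes (k, l), for successive l > k, clear the entries of w
    after position k.  As soon as one rotation is made, its angle can be chosen to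
    leave a nonnegative entry at k, which settles the sign of the pivot. *)
Let clear_row k w l : (l <= N)%N -> exists Q, [/\ K Q,
  forall i, (i < k)%N -> e_ i *m Q = e_ i,
  forall j, (k < j)%N -> (j < l)%N -> (w *m Q) 0 j = 0
  & (k.+1 < l)%N -> 0 <= (w *m Q) 0 k].
Proof.
elim: l => [_|l IH lN]; first by exists 1%:M; split=> // i _; rewrite mulmx1.
have [Q [KQ Qe Qw Qk]] := IH (ltnW lN).
have [lk|kl] := leqP l k.
  exists Q; split=> // [j kj|].
    by rewrite ltnS => jl; have := leq_trans kj (leq_trans jl lk); rewrite ltnn.
  by rewrite ltnS => /leq_trans/(_ lk); rewrite ltnn.
pose o := Ordinal lN.
have ko : k != o by rewrite neq_ltn kl.
have [t [t1 t2]] := givens_angle ((w *m Q) 0 k) ((w *m Q) 0 o).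
have [wk wo wj] := row_rot (w *m Q) t ko.
exists (Q *m rot k o t); split=> [|i ik|j kj|_].
- by apply: KM => //; exact: Krot.
- rewrite mulmxA Qe // delta_rot_id // neq_ltn ?ik //.
  by rewrite (ltn_trans ik kl).
- rewrite ltnS leq_eqVlt mulmxA => /orP[/eqP jo|jl].
    by rewrite (_ : j = o) ?wo //; exact: val_inj.
  rewrite wj ?Qw // neq_ltn; first by rewrite kj orbT.
  by rewrite jl.
- by rewrite mulmxA wk.
Qed.

(** Givens elimination on the rows of A: a row of an orthogonal matrix whose later
    entries are cleared is orthogonal to the earlier basis vectors, hence a basis
    vector up to sign.  The sign is positive by [clear_row], except for the last
    row, where it is the determinant. *)
Lemma rotations_generate : SO R N `<=` H.
Proof.
move=> A [AA dA].
have KA Q : K Q -> (A *m Q) *m (A *m Q)^T = 1%:M /\ \det (A *m Q) = 1.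
  move=> [_ QQ dQ]; rewrite det_mulmx dA dQ mulr1; split=> //.
  by rewrite trmx_mul mulmxA -[A *m Q *m _]mulmxA QQ mulmx1.
suff [Q [KQ HQ]] : exists Q, K Q /\
    forall i : 'I_N, (i < N)%N -> e_ i *m (A *m Q) = e_ i.
  have AQ : A *m Q = 1%:M.
    by apply/row_matrixP => i; rewrite !rowE HQ // mulmx1.
  have [hQ QQ _] := KQ.
  by rewrite -[A]mulmx1 -QQ mulmxA AQ mul1mx.
suff P (k : nat) : (k <= N)%N -> exists Q, K Q /\
    forall i : 'I_N, (i < k)%N -> e_ i *m (A *m Q) = e_ i by exact: P.
elim: k => [_|k IH kN]; first by exists 1%:M.
have [Q [KQ HQ]] := IH (ltnW kN).
pose o := Ordinal kN.
have [Q' [KQ' Qe Qw Qk]] := clear_row o (e_ o *m (A *m Q)) (leqnn N).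
have KQQ := KM KQ KQ'; exists (Q *m Q'); split=> // i.
have [orth det1] := KA _ KQQ.
set B := A *m (Q *m Q') in orth det1 *.
have Bi (j : 'I_N) : (j < k)%N -> e_ j *m B = e_ j.
  by move=> jk; rewrite /B mulmxA mulmxA -[_ *m A *m Q]mulmxA HQ // Qe.
rewrite ltnS leq_eqVlt => /orP[/eqP io|]; last exact: Bi.
have {io} -> : i = o by exact: val_inj.
have oB : e_ o *m B = e_ o *m (A *m Q) *m Q' by rewrite /B !mulmxA.
have oBj j : j != o -> (e_ o *m B) 0 j = 0.
  rewrite neq_ltn => /orP[jo|oj]; last by rewrite oB; apply: Qw.
  have : (e_ o *m B) *m (e_ j *m B)^T = 0.
    rewrite trmx_mul mulmxA -[_ *m B *m _]mulmxA orth mulmx1 mul_delta_trmx.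
    by rewrite (_ : (o == j) = false) ?raddf0 //; apply/negbTE; rewrite neq_ltn jo orbT.
  by rewrite (Bi j jo) trmx_delta -colE => /(congr1 (fun M : 'M[R]_1 => M 0 0)); rewrite !mxE.
pose a := (e_ o *m B) 0 o.
have oBE : e_ o *m B = a *: e_ o.
  apply/rowP => j; rewrite [RHS]mxE [e_ o 0 j]mxE eqxx /=.
  by have [->|/oBj ->] := eqVneq j o; rewrite ?mulr1 ?mulr0.
suff a1 : a = 1 by rewrite oBE a1 scale1r.
have a2 : a ^+ 2 = 1.
  have : (e_ o *m B) *m (e_ o *m B)^T = 1%:M.
    by rewrite trmx_mul mulmxA -[_ *m B *m _]mulmxA orth mulmx1 mul_delta_trmx eqxx.
  rewrite oBE linearZ /= -scalemxAl -scalemxAr mul_delta_trmx eqxx scalerA.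
  by move=> /(congr1 (fun M : 'M[R]_1 => M 0 0)); rewrite !mxE eqxx mulr1 expr2.
move/eqP: a2; rewrite sqrf_eq1 => /orP[/eqP //|/eqP am1].
have [kN1|kN1] := ltnP k.+1 N.
  by have := Qk kN1; rewrite -oB -/a am1; lra.
have BD : B = diag_mx (\row_j (if j == o then a else 1)).
  apply/row_matrixP => j; rewrite rowE row_diag_mx mxE.
  have [->|jo] := eqVneq j o; first exact: oBE.
  rewrite scale1r Bi // ltn_neqAle; apply/andP; split; first exact: jo.
  by rewrite -ltnS (leq_trans (ltn_ord j)).
move: det1; rewrite BD det_diag (bigD1 o) //= mxE eqxx big1 ?mulr1 //.
by move=> j /negbTE jo; rewrite mxE jo.
Qed.

End Generation.
End Rotations.

(** * Turns along the basis fields *)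

Section CarnotLoops.
Variables (R : realType) (m : nat).
Local Notation n := (npairs m).
Local Notation N := (m + npairs m)%N.
Local Notation G := 'rV[R]_N.
Local Notation e_ i := (delta_mx 0 i : 'rV[R]_N).
Implicit Types (x u w : G) (i j : 'I_m) (p : pairs m) (a b : 'I_N).

Definition hor i : 'I_N := lshift n i.
Definition ver p : 'I_N := rshift m (enum_rank p).

Lemma vcoord_hor i j : vcoord (e_ (hor i)) j = (j == i)%:R.
Proof. by rewrite /vcoord delta_rowE eq_lshift. Qed.

Lemma vcoord_ver p j : vcoord (e_ (ver p)) j = 0.
Proof. by rewrite /vcoord delta_rowE eq_lrshift. Qed.

Lemma gcoord_ver p q : gcoord (e_ (ver p)) q = (q == p)%:R.
Proof. by rewrite /gcoord delta_rowE eq_rshift (inj_eq enum_rank_inj). Qed.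

Lemma index_cases a : (exists i, a = hor i) \/ (exists p, a = ver p).
Proof.
case: (split_ordP a) => k ->; [by left; exists k | right].
by exists (enum_val k); rewrite /ver enum_valK.
Qed.

Lemma kidx_lt_hidx p : (kidx p < hidx p)%N.
Proof. exact: valP p. Qed.

Lemma pair_eq p q : (q == p) = (hidx q == hidx p) && (kidx q == kidx p).
Proof.
rewrite -val_eqE /hidx /kidx; case: (val q) (val p) => [? ?] [? ?].
exact: xpair_eqE.
Qed.

Lemma shear_hor b i w : (e_ b *m shear w) 0 (hor i) = 0.
Proof. exact: vcoord_shear. Qed.

Lemma shear_entry_hor w b i : shear w b (hor i) = 0.
Proof. by have := shear_hor b i w; rewrite -rowE mxE. Qed.

Lemma shear_entry_ver w b p : shear w b (ver p) = 2^-1 *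
  (vcoord w (hidx p) * vcoord (e_ b) (kidx p) -
   vcoord w (kidx p) * vcoord (e_ b) (hidx p)).
Proof. by rewrite -gcoord_shear /gcoord -rowE [RHS]mxE. Qed.

Lemma shear_entry_row w p c : shear w (ver p) c = 0.
Proof.
case: (index_cases c) => [[i ->]|[q ->]]; first exact: shear_entry_hor.
by rewrite shear_entry_ver !vcoord_ver !mulr0 subrr mulr0.
Qed.

Lemma shear_ver p : shear (e_ (ver p)) = 0.
Proof.
apply/matrixP => b c; rewrite [RHS]mxE.
case: (index_cases c) => [[i ->]|[q ->]]; first exact: shear_entry_hor.
by rewrite shear_entry_ver !vcoord_ver !mul0r subrr mulr0.
Qed.

(** The nonzero eigenvalues of [spin (e_ a)] are i/2 and -i/2; the factor 2 gives
    [generator_cube], so that Rodrigues' formula applies. *)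
Definition generator a : 'M[R]_N := 2 *: spin (e_ a).

Lemma generatorE a b c : generator a b c =
  2 * (shear (e_ a) b c - shear (e_ a) c b - shear (e_ b) c a).
Proof. by rewrite -spin_delta /generator mxE. Qed.

Lemma generator_trmx a : (generator a)^T = - generator a.
Proof. by rewrite /generator linearZ /= spin_anti scalerN. Qed.

Lemma generator_rowE a b w : (forall c, generator a b c = w 0 c) ->
  e_ b *m generator a = w.
Proof. by move=> E; apply/rowP => c; rewrite -rowE mxE E. Qed.

Lemma generator_hor_hor i j : e_ (hor j) *m generator (hor i) =
  2 *: (e_ (hor j) *m shear (e_ (hor i))).
Proof.
apply: generator_rowE => c; rewrite generatorE !shear_entry_hor !subr0.
by rewrite [RHS]mxE -rowE; congr (_ * _); rewrite [RHS]mxE.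
Qed.

(** This is [X_h, X_k] = Gamma_{h,k} for h > k. *)
Lemma shear_pair p : e_ (hor (kidx p)) *m shear (e_ (hor (hidx p))) =
  2^-1 *: e_ (ver p).
Proof.
have kh : (kidx p == hidx p) = false by apply/negbTE; rewrite neq_ltn kidx_lt_hidx.
apply: point_eq => [i|q].
  by rewrite vcoord_shear /vcoord mxE -/(vcoord _ _) vcoord_ver mulr0.
rewrite gcoord_shear !vcoord_hor [RHS]/gcoord [RHS]mxE -/(gcoord _ _) gcoord_ver pair_eq.
congr (_ * _); have [-> /=|hq] := eqVneq (hidx q) (hidx p).
  rewrite eq_sym in kh; rewrite kh mulr0 subr0 mul1r //.
rewrite !mul0r sub0r /=; have [kq|_] := eqVneq (kidx q) (hidx p); last first.
  by rewrite mul0r oppr0.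
have [hq'|_] := eqVneq (hidx q) (kidx p); last by rewrite mulr0 oppr0.
have := kidx_lt_hidx q; rewrite kq hq' => /ltn_trans/(_ (kidx_lt_hidx p)).
by rewrite ltnn.
Qed.

Lemma generator_k p : e_ (hor (kidx p)) *m generator (hor (hidx p)) = e_ (ver p).
Proof. by rewrite generator_hor_hor shear_pair scalerA mulfV ?scale1r. Qed.

Lemma generator_h p : e_ (hor (hidx p)) *m generator (hor (kidx p)) = - e_ (ver p).
Proof.
by rewrite generator_hor_hor mul_shear_anti shear_pair scalerN scalerA mulfV ?scale1r.
Qed.

Lemma generator_self i : e_ (hor i) *m generator (hor i) = 0.
Proof. by rewrite generator_hor_hor mul_shear_self scaler0. Qed.

Lemma generator_ver i p : e_ (ver p) *m generator (hor i) =
  (i == kidx p)%:R *: e_ (hor (hidx p)) - (i == hidx p)%:R *: e_ (hor (kidx p)).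
Proof.
apply: generator_rowE => c.
rewrite generatorE shear_entry_row shear_ver [X in _ - X]mxE subr0 sub0r.
rewrite shear_entry_ver !vcoord_hor.
have -> : ((i == kidx p)%:R *: e_ (hor (hidx p)) -
   (i == hidx p)%:R *: e_ (hor (kidx p))) 0 c =
   (i == kidx p)%:R * vcoord (e_ c) (hidx p) - (i == hidx p)%:R * vcoord (e_ c) (kidx p).
  by rewrite !mxE /vcoord !mxE !eqxx /= ![c == _]eq_sym.
by rewrite ![_ == i]eq_sym; field.
Qed.

Lemma generator_vertical p :
  generator (ver p) = plane (e_ (hor (kidx p))) (e_ (hor (hidx p))).
Proof.
apply/row_matrixP => b; rewrite !rowE mul_delta_plane.
apply: generator_rowE => c.
rewrite generatorE shear_ver ![(0 : 'M[R]_N) _ _]mxE subr0 sub0r shear_entry_ver.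
have dE a i : vcoord (e_ a) i = (a == hor i)%:R by rewrite /vcoord delta_rowE eq_sym.
by rewrite !dE !mxE !eqxx /=; field.
Qed.

(** The generator of X_i exchanges, up to sign, each X_j with the vertical vector
    of the pair {i, j}, and kills X_i and the other vertical vectors; that of a
    vertical vector is covered by [plane_cube]. *)
Lemma generator_cube a : generator a *m generator a *m generator a = - generator a.
Proof.
case: (index_cases a) => [[i ->]|[p ->]]; last first.
  rewrite generator_vertical; apply: plane_cube.
  by rewrite /hor eq_lshift neq_ltn kidx_lt_hidx.
apply/row_matrixP => b; rewrite !rowE !mulmxA mulmxN.
have kh p : (kidx p == hidx p) = false by apply/negbTE; rewrite neq_ltn kidx_lt_hidx.
have hk p : (hidx p == kidx p) = false by rewrite eq_sym kh.
have Jh p : e_ (ver p) *m generator (hor (hidx p)) = - e_ (hor (kidx p)).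
  by rewrite generator_ver eqxx hk scale0r scale1r sub0r.
have Jk p : e_ (ver p) *m generator (hor (kidx p)) = e_ (hor (hidx p)).
  by rewrite generator_ver eqxx kh scale0r scale1r subr0.
case: (index_cases b) => [[j ->]|[p ->]].
  have [ij|ji|ij] := ltngtP i j.
  - pose p : pairs m := exist _ (j, i) ij.
    by rewrite -[j]/(hidx p) -[i]/(kidx p) generator_h !mulNmx Jk generator_h.
  - pose p : pairs m := exist _ (i, j) ji.
    by rewrite -[i]/(hidx p) -[j]/(kidx p) generator_k Jh mulNmx generator_k.
  - by rewrite (val_inj ij : i = j) generator_self !mul0mx oppr0.
have [->|ik] := eqVneq i (kidx p); first by rewrite Jk generator_h mulNmx Jk.
have [->|ih] := eqVneq i (hidx p); first by rewrite Jh !mulNmx generator_k Jh.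
by rewrite generator_ver (negbTE ik) (negbTE ih) !scale0r subrr !mul0mx oppr0.
Qed.

(** The factor -2 makes up for the minus sign of the parallel equation and for the
    factor 2 in [generator]. *)
Lemma steer_turn x a t : steer x (star x ((-2 * t) *: e_ a)) (turn (generator a) t).
Proof.
rewrite starE -[t in turn _ t]mulr1.
apply: (@steer_line _ _ _ _ (fun s => turn (generator a) (t * s))).
- exact: turn_lip.
- by rewrite mulr0 turn0.
move=> s; have := turn_derive t s (generator_cube a).
rewrite scalemxAr; congr mx_derive; rewrite -mulmxN; congr (_ *m _).
by rewrite [spin _]linearZ /= -scaleNr /generator scalerA; congr (_ *: _); ring.
Qed.

Lemma shear_star x u : shear (star x u) = shear x + shear u.
Proof. by rewrite starE shearD shear_frame. Qed.

(** A rectangle fails to close by the bracket of its sides. *)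
Lemma star_square x u w : star (star (star (star x u) w) (- u)) (- w) =
  x + 2 *: (w *m shear u).
Proof.
have sE y v : star y v = y + v + v *m shear y.
  by rewrite starE frameE mulmxDr mulmx1 addrA.
rewrite sE !shear_star sE !shear_star sE shear_star sE.
have sN v : shear (- v) = - shear v by rewrite -scaleN1r shearZ scaleN1r.
rewrite sN !mulmxDr !mulNmx !mulmxN !mul_shear_self (mul_shear_anti w u).
rewrite scaler_nat mulr2n; apply/rowP => i; rewrite !mxE; ring.
Qed.

Lemma star_back x u : star (star x u) (- u) = x.
Proof.
rewrite [LHS]starE frameE shear_star mulmxDr mulmx1 mulmxDr !mulNmx.
rewrite mul_shear_self oppr0 addr0 starE frameE mulmxDr mulmx1.
by apply/rowP => i; rewrite !mxE; ring.
Qed.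

End CarnotLoops.

(** * Loops and the holonomy group *)

Section Holonomy.
Variables (R : realType) (m : nat).
Local Notation N := (m + npairs m)%N.
Local Notation G := 'rV[R]_N.
Local Notation e_ i := (delta_mx 0 i : 'rV[R]_N).
Implicit Types (x u w : G) (i j : 'I_m) (p : pairs m) (a b : 'I_N) (Q : 'M[R]_N).

(** By left invariance the base point is irrelevant; asking for all of them at once
    makes [loop_rotation_conj] immediate. *)
Definition loop_rotation Q := forall x, steer x x Q.

Lemma loop_rotation1 : loop_rotation 1%:M.
Proof.
move=> x; have := @steer_line R m x 0 (fun=> 1%:M).
rewrite mul0mx addr0; apply=> //.
  by move=> i j; exact: lip01_cst.
by move=> t; rewrite linear0 mulmx0 oppr0; exact: mx_derive_cst.
Qed.

Lemma loop_rotationM Q Q' :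
  loop_rotation Q -> loop_rotation Q' -> loop_rotation (Q *m Q').
Proof. by move=> hQ hQ' x; exact: steer_trans (hQ x) (hQ' x). Qed.

(** Travel along e_a, follow the loop given by Q at the new base point, and travel
    back. *)
Lemma loop_rotation_conj a t Q : loop_rotation Q ->
  loop_rotation (turn (generator R a) t *m Q *m turn (generator R a) (- t)).
Proof.
move=> hQ x; pose y := star x ((-2 * t) *: e_ a).
apply: steer_trans (steer_trans (steer_turn x a t) (hQ y)) _.
have := steer_turn y a (- t); congr steer.
by rewrite mulrN scaleNr /y star_back.
Qed.

Lemma turn_2pi (J : 'M[R]_N) : turn J (pi *+ 2) = 1%:M.
Proof. by rewrite /turn sin2pi cos2pi subrr !scale0r !addr0. Qed.

Lemma turn_N2pi (J : 'M[R]_N) : turn J (- (pi *+ 2)) = 1%:M.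
Proof. by rewrite -turnN turn_2pi. Qed.

Lemma turn_pihalf (J : 'M[R]_N) : turn J (pi / 2) = 1%:M + J + J *m J.
Proof. by rewrite /turn sin_pihalf cos_pihalf subr0 !scale1r. Qed.

Lemma turn_generator_opp a t :
  turn (generator R a) t *m turn (generator R a) (- t) = 1%:M.
Proof. by rewrite turnD ?generator_cube // subrr turn0. Qed.

Lemma steer_square x u w Q1 Q2 Q3 Q4 :
  (forall y, steer y (star y u) Q1) -> (forall y, steer y (star y w) Q2) ->
  (forall y, steer y (star y (- u)) Q3) -> (forall y, steer y (star y (- w)) Q4) ->
  steer x (x + 2 *: (w *m shear u)) (Q1 *m Q2 *m Q3 *m Q4).
Proof.
move=> S1 S2 S3 S4; rewrite -star_square.
exact: steer_trans (steer_trans (steer_trans (S1 _) (S2 _)) (S3 _)) (S4 _).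
Qed.

(** A full period along X_h turns nothing, so the rectangle of sides U and W has
    trivial transport while its end points differ by a multiple of Gamma_{h,k}.
    The return along Gamma_{h,k} rotates the plane (X_k, X_h) only. *)
Lemma horizontal_rotation p t :
  loop_rotation (rot (hor (kidx p)) (hor (hidx p)) t).
Proof.
(* The sides of the rectangle are 2 T and 2 s along X_h and X_k, so that it
   displaces by 4 T s = 2 t along Gamma_{h,k}, the length of the return. *)
move=> x; pose T : R := pi *+ 2; pose s := t / (pi * 4).
pose U := (-2 * T) *: e_ (hor (hidx p)); pose W := (-2 * s) *: e_ (hor (kidx p)).
have S1 y : steer y (star y U) 1%:M.
  by rewrite -(turn_2pi (generator R (hor (hidx p)))); exact: steer_turn.
have S2 y : steer y (star y W) (turn (generator R (hor (kidx p))) s).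
  exact: steer_turn.
have S3 y : steer y (star y (- U)) 1%:M.
  rewrite -(turn_N2pi (generator R (hor (hidx p)))) -scaleNr -mulrN.
  exact: steer_turn.
have S4 y : steer y (star y (- W)) (turn (generator R (hor (kidx p))) (- s)).
  rewrite -scaleNr -mulrN; exact: steer_turn.
have S5 y := steer_turn y (ver p) t.
have := steer_trans (steer_square x S1 S2 S3 S4) (S5 _).
rewrite mul1mx mulmx1 turn_generator_opp mul1mx generator_vertical -/(rot _ _ _).
congr steer; rewrite /W /U shearZ -scalemxAl -scalemxAr shear_pair.
rewrite starE frameE mulmxDr mulmx1 -[(-2 * t) *: _ *m _]scalemxAl.
have -> : e_ (ver p) *m shear (x + 2 *: ((-2 * s) *: ((-2 * T) *: (2^-1 *: e_ (ver p))))) = 0.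
  apply/rowP => c; rewrite -rowE mxE shear_entry_row [RHS]mxE //.
rewrite scaler0 addr0 -addrA !scalerA -scalerDl.
have -> : 2 * (-2 * s) * (-2 * T) / 2 + -2 * t = 0; last by rewrite scale0r addr0.
have pi0 : pi != 0 :> R by rewrite gt_eqF // pi_gt0.
by rewrite /s /T; move: pi pi0 => q q0; field.
Qed.

(** Conjugate [horizontal_rotation] by a quarter turn along X_h, which fixes X_h
    and sends X_k to Gamma_{h,k}. *)
Lemma vertical_rotation p t : loop_rotation (rot (ver p) (hor (hidx p)) t).
Proof.
pose M := turn (generator R (hor (hidx p))) (pi / 2).
have MM : M *m M^T = 1%:M.
  by apply: turn_orthogonal; [exact: generator_cube | exact: generator_trmx].
have := loop_rotation_conj (hor (hidx p)) (- (pi / 2)) (horizontal_rotation p t).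
rewrite opprK -turn_trmx ?generator_trmx // -/M /rot turn_conj // plane_conj.
have -> : e_ (hor (kidx p)) *m M = e_ (ver p).
  rewrite /M turn_pihalf !mulmxDr mulmx1 mulmxA generator_k generator_ver eqxx.
  have -> : (hidx p == kidx p) = false.
    by apply/negbTE; rewrite neq_ltn kidx_lt_hidx orbT.
  by rewrite scale0r scale1r sub0r addrAC subrr add0r.
have -> // : e_ (hor (hidx p)) *m M = e_ (hor (hidx p)).
by rewrite /M turn_pihalf !mulmxDr mulmx1 mulmxA generator_self mul0mx !addr0.
Qed.

Definition rotatable a b := a = b \/ forall t, loop_rotation (rot a b t).

Lemma rotatable_sym a b : rotatable a b -> rotatable b a.
Proof.
by move=> [->|h]; [left | right => t; rewrite rot_sym; exact: h].
Qed.

(** Conjugation by a quarter turn in the plane (a, b) carries the plane (b, c) to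
    the plane (a, c). *)
Lemma rotatable_trans a b c : rotatable a b -> rotatable b c -> rotatable a c.
Proof.
have [->|ab] := eqVneq a b; first by [].
have [->|bc] := eqVneq b c; first by [].
have [->|ac] := eqVneq a c; first by left.
move=> [/eqP|hab]; first by rewrite (negbTE ab).
move=> [/eqP|hbc]; first by rewrite (negbTE bc).
right=> t; pose M := rot a b (pi / 2 : R).
have J3 := plane_cube R ab; have JT := plane_trmx (e_ a) (e_ b).
have MM : M *m M^T = 1%:M by exact: turn_orthogonal.
have MT : M^T = rot a b (- (pi / 2)) by exact: turn_trmx.
have := loop_rotationM (loop_rotationM (hab (- (pi / 2))) (hbc (- t))) (hab (pi / 2)).
rewrite -MT -/M {1}/rot turn_conj // plane_conj.
have -> : e_ b *m M = - e_ a.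
  rewrite /M rot_sym delta_rot 1?eq_sym // cosN sinN cos_pihalf sin_pihalf.
  by rewrite scale0r add0r scaleN1r.
have -> : e_ c *m M = e_ c by rewrite /M delta_rot_id // eq_sym.
by rewrite planeNl turnN opprK.
Qed.

Lemma rotatable_hor i j : rotatable (hor i) (hor j).
Proof.
have [ij|ji|/val_inj ->] := ltngtP i j; last by left.
  right=> t; pose p : pairs m := exist _ (j, i) ij; exact: (horizontal_rotation p).
apply: rotatable_sym; right=> t; pose p : pairs m := exist _ (i, j) ji.
exact: (horizontal_rotation p).
Qed.

Lemma rotatable_index a : exists i, rotatable a (hor i).
Proof.
case: (index_cases a) => [[i ->]|[p ->]]; first by exists i; left.
by exists (hidx p); right=> t; exact: vertical_rotation.
Qed.

Lemma loop_rotation_SO : SO R N `<=` loop_rotation.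
Proof.
apply: rotations_generate loop_rotation1 loop_rotationM _ => a b t ab.
have [i ai] := rotatable_index a; have [j bj] := rotatable_index b.
have [/eqP|//] : rotatable a b; last by rewrite (negbTE ab).
apply: rotatable_trans ai _; apply: rotatable_trans (rotatable_hor i j) _.
exact: rotatable_sym.
Qed.

(** The frame is unipotent. *)
Lemma coframe_det x : \det (coframe x : 'M[R]_N) = 1.
Proof.
have : \det (frame x) = 1 by rewrite /frame det_ublock !det1 mulr1.
have := congr1 (fun A : 'M[R]_N => \det A) (mul_frame_coframe x).
by rewrite /= det_mulmx det1 => + dF; rewrite dF mul1r.
Qed.

(** The rows of [B *m coframe x] are the frame coordinates of the basis, in which
    the metric is the standard one. *)
Lemma oriented_basis_coords x (B : 'M[R]_N) :
  oriented_orthonormal_basis (carnot_metric R m) x B ->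
  SO R N (B *m coframe x).
Proof.
move=> [orth dB].
have OO : (B *m coframe x) *m (B *m coframe x)^T = 1%:M.
  apply/matrixP => a b; rewrite [RHS]mxE -orth carnot_metricE -!row_mul.
  by rewrite mxE; apply: eq_bigr => c _; rewrite !mxE.
split=> //; have [//|] := orthogonal_det OO.
by rewrite det_mulmx coframe_det mulr1; lra.
Qed.

End Holonomy.

Theorem theorem4p3 (R : realType) (m : nat) (hm : (2 <= m)%N)
    (D : connection R (m + npairs m))
    (hD : levi_civita (carnot_metric R m) D)
    (x : 'rV[R]_(m + npairs m)) (B : 'M[R]_(m + npairs m))
    (hB : oriented_orthonormal_basis (carnot_metric R m) x B) :
  holonomy_in_basis D x B = SO R (m + npairs m).
Proof.
have [CC dC] := oriented_basis_coords hB.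
have [C CE] : exists C, C = B *m coframe x by exists (B *m coframe x).
rewrite -CE in CC dC.
have CC' : C^T *m C = 1%:M by exact: mulmx1C.
have BE : B = C *m frame x by rewrite CE -mulmxA mul_coframe_frame mulmx1.
have BK : B *m (coframe x *m C^T) = 1%:M.
  by rewrite BE mulmxA -[C *m _ *m _]mulmxA mul_frame_coframe mulmx1.
have iB : invmx B = coframe x *m C^T.
  have [uB _] := mulmx1_unit BK.
  by rewrite -[RHS]mul1mx -(mulVmx uB) -mulmxA BK mulmx1.
apply/seteqP; split=> [_ [P [c [acc c0 c1 tr]] <-]|A [AA dA]].
  have := transport_SO hD acc tr; rewrite c0 c1 => -[QQ dQ].
  move: QQ dQ; set Q := frame x *m P *m coframe x => QQ dQ.
  have -> : B *m P *m invmx B = C *m Q *m C^T by rewrite iB {1}BE /Q !mulmxA.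
  clearbody Q; split; last by rewrite !det_mulmx det_tr dC dQ !mulr1.
  rewrite !trmx_mul trmxK !mulmxA -[C *m Q *m C^T *m C]mulmxA CC' mulmx1.
  by rewrite -[C *m Q *m Q^T]mulmxA QQ mulmx1.
have QSO : SO R _ (C^T *m A *m C).
  split; last by rewrite !det_mulmx det_tr dC dA !mulr1.
  rewrite !trmx_mul trmxK !mulmxA -[C^T *m A *m C *m C^T]mulmxA CC mulmx1.
  by rewrite -[C^T *m A *m A^T]mulmxA AA mulmx1.
have [c [acc c0 c1 tr]] := steer_transport hD (loop_rotation_SO QSO x).
exists (coframe x *m (C^T *m A *m C) *m frame x); first by exists c.
rewrite iB {1}BE !mulmxA -[C *m frame x *m coframe x]mulmxA mul_frame_coframe.
rewrite mulmx1 CC mul1mx -[_ *m frame x *m coframe x]mulmxA mul_frame_coframe.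
by rewrite mulmx1 -mulmxA CC mulmx1.
Qed.
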